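(* Let $(A,B)$ be an $m\times n$ bimatrix game such that $P=\{x\in\mathbb R^m\mid x\ge0,\ B^\top x\le\mathbf 1\}$ and $Q=\{y\in\mathbb R^n\mid Ay\le\mathbf 1,\ y\ge0\}$ are polytopes. Let $d=m+n$, $C=\begin{bmatrix}0&A\\ B^\top&0\end{bmatrix}$ (a $d\times d$ matrix), write $C^\top=[c_1\cdots c_d]$, and let $S=\{z\in\mathbb R^d\mid z\ge 0,\ Cz\le\mathbf 1\}$. The following are equivalent: (a) $(A,B)$ is nondegenerate. (b) No point of $P$ has more than $m$ labels and no point of $Q$ has more than $n$ labels. (c) The symmetric game $(C,C^\top)$ is nondegenerate. (d) For no $z\in S$ are more than $d$ of the inequalities $z\ge0$, $Cz\le\mathbf 1$ binding. (e) For every $z\in S$, the row vectors $e_i^\top$ (for $i$ with $z_i=0$) and $c_j^\top$ (for $j$ with $c_j^\top z=1$) are linearly independent. (f) For all $\hat x\in X$ and $\hat y\in Y$: with $I=\mathrm{supp}(\hat x)$, $J=\mathrm{bestresp}(\hat x)$, $K=\mathrm{bestresp}(\hat y)$, $L=\mathrm{supp}(\hat y)$, the columns of the submatrix $B_{IJ}=(b_{ij})_{i\in I,j\in J}$ are linearly independent and the rows of $A_{KL}=(a_{ij})_{i\in K,j\in L}$ are linearly independent. (g) For all $\hat x\in X$ and $\hat y\in Y$: if $I$ is the set of labels of $\hat x$ and $J$ the set of labels of $\hat y$, then $P(I)$ has dimension $m-|I|$ and $Q(J)$ has dimension $n-|J|$. (h) $P$ and $Q$ are simple polytopes, and for each of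 them every inequality in its defining system that is redundant (can be omitted without changing the polytope) is never binding. (i) $P$ and $Q$ are simple polytopes, and every pure strategy of either player that is weakly dominated by or payoff equivalent to a different mixed strategy is strictly dominated.
   Context: $A,B$ real $m\times n$; $\mathbf 1$ all-ones vector; $e_i$ unit vectors; inequalities componentwise. $X=\{x\in\mathbb R^m\mid x\ge0,\sum_ix_i=1\}$, $Y=\{y\in\mathbb R^n\mid y\ge0,\sum_jy_j=1\}$. $\mathrm{supp}(z)=\{k\mid z_k>0\}$; $\mathrm{bestresp}(y)=\{i\mid (Ay)_i=\max_k(Ay)_k\}$ for $y\in Y$; $\mathrm{bestresp}(x)=\{j\mid (B^\top x)_j=\max_k(B^\top x)_k\}$ for $x\in X$. A bimatrix game $(A,B)$ is nondegenerate if $|\mathrm{bestresp}(z)|\le|\mathrm{supp}(z)|$ for all $z\in X$ and all $z\in Y$ (for $(C,C^\top)$ the same definition applies with both strategy sets the simplex in $\mathbb R^d$). Labels: $x\in X$ has label $i\le m$ if $x_i=0$ and label $m+j$ if $j\in\mathrm{bestresp}(x)$; $y\in Y$ has label $m+j$ if $y_j=0$ and label $i\le m$ if $i\in\mathrm{bestresp}(y)$. $x\in P$ has label $i\le m$ if $x_i=0$ and label $m+j$ if $(B^\top x)_j=1$; $y\in Q$ has label $i\le m$ if $(Ay)_i=1$ and label $m+j$ if $y_j=0$. In $S$, $z$ has label $i$ if $z_i=0$ or $c_i^\top z=1$. For $I,J\subseteq\{1,\ldots,m+n\}$: $P(I)=\{x\in P\mid x$ has at least all labels in $I\}$, $Q(J)=\{y\in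 Q\mid y$ has at least all labels in $J\}$; dimension means affine dimension. A $k$-dimensional polytope is simple if no point lies on more than $k$ facets. For player 1, pure strategy $i$ (row $a_i^\top$ of $A$) is weakly dominated by or payoff equivalent to a mixed strategy $x\in X$, $x\ne e_i$, if $a_i^\top\le x^\top A$ componentwise, and strictly dominated if $a_i^\top< x'^\top A$ componentwise for some $x'\in X$; analogously for player 2 with columns of $B$ and $y\in Y$ ($B e_j\le By$, resp. $Be_j<By'$). *)

(* Defs.v *)
From HB Require Import structures.
From mathcomp Require Import all_boot all_order all_algebra.
Set Implicit Arguments. Unset Strict Implicit. Unset Printing Implicit Defensive.
Import Order.TTheory GRing.Theory Num.Theory.
Local Open Scope ring_scope.

Section Defs.
Variable R : realFieldType.

Definition inSimplex k (x : 'cV[R]_k) : Prop :=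
  (forall i, 0 <= x i ord0) /\ \sum_i x i ord0 = 1.

Definition supp k (z : 'cV[R]_k) : {set 'I_k} := [set i | 0 < z i ord0].

Definition bestresp_y m n (A : 'M[R]_(m, n)) (y : 'cV[R]_n) : {set 'I_m} :=
  [set i | [forall k, (A *m y) k ord0 <= (A *m y) i ord0]].
Definition bestresp_x m n (B : 'M[R]_(m, n)) (x : 'cV[R]_m) : {set 'I_n} :=
  [set j | [forall k, (B^T *m x) k ord0 <= (B^T *m x) j ord0]].

Definition nondeg_game m n (A B : 'M[R]_(m, n)) : Prop :=
  (forall x, inSimplex x -> #|bestresp_x B x| <= #|supp x|)%N /\
  (forall y, inSimplex y -> #|bestresp_y A y| <= #|supp y|)%N.

(* Labels 1..m+n are encoded as 'I_(m+n): label i<=m is lshift n i (i : 'I_m),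
   label m+j is rshift m j (j : 'I_n). *)

Definition labelsX m n (B : 'M[R]_(m, n)) (x : 'cV[R]_m) : {set 'I_(m + n)} :=
  [set l | match split l with
           | inl i => x i ord0 == 0
           | inr j => j \in bestresp_x B x end].
Definition labelsY m n (A : 'M[R]_(m, n)) (y : 'cV[R]_n) : {set 'I_(m + n)} :=
  [set l | match split l with
           | inl i => i \in bestresp_y A y
           | inr j => y j ord0 == 0 end].

Definition inP m n (B : 'M[R]_(m, n)) (x : 'cV[R]_m) : Prop :=
  (forall i, 0 <= x i ord0) /\ (forall j, (B^T *m x) j ord0 <= 1).
Definition inQ m n (A : 'M[R]_(m, n)) (y : 'cV[R]_n) : Prop :=
  (forall i, (A *m y) i ord0 <= 1) /\ (forall j, 0 <= y j ord0).

Definition ineqP m n (B : 'M[R]_(m, n)) (l : 'I_(m + n)) (x : 'cV[R]_m) : Prop :=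
  match split l with inl i => 0 <= x i ord0 | inr j => (B^T *m x) j ord0 <= 1 end.
Definition ineqQ m n (A : 'M[R]_(m, n)) (l : 'I_(m + n)) (y : 'cV[R]_n) : Prop :=
  match split l with inl i => (A *m y) i ord0 <= 1 | inr j => 0 <= y j ord0 end.

Definition labelsP m n (B : 'M[R]_(m, n)) (x : 'cV[R]_m) : {set 'I_(m + n)} :=
  [set l | match split l with
           | inl i => x i ord0 == 0
           | inr j => (B^T *m x) j ord0 == 1 end].
Definition labelsQ m n (A : 'M[R]_(m, n)) (y : 'cV[R]_n) : {set 'I_(m + n)} :=
  [set l | match split l with
           | inl i => (A *m y) i ord0 == 1
           | inr j => y j ord0 == 0 end].

Definition PI m n (B : 'M[R]_(m, n)) (I : {set 'I_(m + n)}) (x : 'cV[R]_m) : Prop :=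
  inP B x /\ I \subset labelsP B x.
Definition QJ m n (A : 'M[R]_(m, n)) (J : {set 'I_(m + n)}) (y : 'cV[R]_n) : Prop :=
  inQ A y /\ J \subset labelsQ A y.

Definition bounded_set k (S : 'cV[R]_k -> Prop) : Prop :=
  exists M : R, forall x, S x -> forall i, `|x i ord0| <= M.

Definition aff_indep k N (p : 'I_N -> 'cV[R]_k) : Prop :=
  forall lam : 'I_N -> R, \sum_i lam i = 0 -> \sum_i lam i *: p i = 0 ->
    forall i, lam i = 0.

(* affine dimension: affdim S d  <->  dim aff(S) = d  (with dim of empty set = -1),
   i.e. d+1 is the maximal number of affinely independent points of S *)
Definition affdim k (S : 'cV[R]_k -> Prop) (d : int) : Prop :=
  (d = -1 /\ forall x, ~ S x) \/
  exists N : nat, d = N%:Z /\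
    (exists p : 'I_N.+1 -> 'cV[R]_k, (forall i, S (p i)) /\ aff_indep p) /\
    (forall p : 'I_N.+2 -> 'cV[R]_k, (forall i, S (p i)) -> ~ aff_indep p).

Definition face_of k (S F : 'cV[R]_k -> Prop) : Prop :=
  exists (c : 'cV[R]_k) (c0 : R),
    (forall x, S x -> (c^T *m x) ord0 ord0 <= c0) /\
    (forall x, F x <-> (S x /\ (c^T *m x) ord0 ord0 = c0)).
Definition facet_of k (S F : 'cV[R]_k -> Prop) : Prop :=
  exists d : int, affdim S d /\ face_of S F /\ affdim F (d - 1).

(* a polytope S (here S is already a polyhedron) is simple if it is bounded and,
   D being its dimension, no point of S lies on more than D (distinct) facets *)
Definition simple_polytope k (S : 'cV[R]_k -> Prop) : Prop :=
  bounded_set S /\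
  forall D : nat, affdim S D%:Z -> forall z, S z ->
    forall F : 'I_D.+1 -> ('cV[R]_k -> Prop),
      (forall i, facet_of S (F i)) ->
      (forall i j, i != j -> ~ (forall y, F i y <-> F j y)) ->
      ~ (forall i, F i z).

Definition redundantP m n (B : 'M[R]_(m, n)) (l : 'I_(m + n)) : Prop :=
  forall x, (forall l', l' != l -> ineqP B l' x) <-> inP B x.
Definition redundantQ m n (A : 'M[R]_(m, n)) (l : 'I_(m + n)) : Prop :=
  forall y, (forall l', l' != l -> ineqQ A l' y) <-> inQ A y.

Definition weakdom1 m n (A : 'M[R]_(m, n)) (i : 'I_m) : Prop :=
  exists x, inSimplex x /\ x != delta_mx i ord0 /\
    forall j, A i j <= (x^T *m A) ord0 j.
Definition strictdom1 m n (A : 'M[R]_(m, n)) (i : 'I_m) : Prop :=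
  exists x, inSimplex x /\ forall j, A i j < (x^T *m A) ord0 j.
Definition weakdom2 m n (B : 'M[R]_(m, n)) (j : 'I_n) : Prop :=
  exists y, inSimplex y /\ y != delta_mx j ord0 /\
    forall i, B i j <= (B *m y) i ord0.
Definition strictdom2 m n (B : 'M[R]_(m, n)) (j : 'I_n) : Prop :=
  exists y, inSimplex y /\ forall i, B i j < (B *m y) i ord0.

Definition cols_indep m n (B : 'M[R]_(m, n)) (I : {set 'I_m}) (J : {set 'I_n}) : Prop :=
  forall mu : 'I_n -> R,
    (forall i, i \in I -> \sum_(j in J) B i j * mu j = 0) ->
    forall j, j \in J -> mu j = 0.
Definition rows_indep m n (A : 'M[R]_(m, n)) (K : {set 'I_m}) (L : {set 'I_n}) : Prop :=
  forall lam : 'I_m -> R,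
    (forall j, j \in L -> \sum_(i in K) lam i * A i j = 0) ->
    forall i, i \in K -> lam i = 0.

End Defs.

(* Main.v *)
Require Import Defs.
From HB Require Import structures.
From mathcomp Require Import all_boot all_order all_algebra.
From Stdlib Require Import Classical FunctionalExtensionality PropExtensionality.
Import Order.TTheory GRing.Theory Num.Theory.
Local Open Scope ring_scope.

(** Every condition is shown equivalent to (b) for both polytopes. Since P is the
polytope Q of the transposed matrix and S is the polytope Q of the matrix C, it
suffices to treat one bounded polyhedron Q = {y >= 0, M y <= 1}. Rescaling the
simplex by the best-response payoff, which is positive because Q is bounded,
identifies the labels of a strategy with the binding inequalities of a point of Q;
this gives (a) and (c). Linear independence of binding rows, as in (e) and (f),
bounds their number by the dimension; conversely a dependence among binding rows
survives when one moves to a vertex, where it yields too many binding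
inequalities. Independence also determines the dimension of the faces (g), and
the inequalities that are not redundant are exactly those defining facets, with
distinct inequalities defining distinct facets, which gives (h). Finally, Farkas'
lemma translates redundancy into weak dominance, and never being binding into
strict dominance (i). *)

Set Implicit Arguments.
Unset Strict Implicit.
Unset Printing Implicit Defensive.

(** * Farkas' lemma *)

Lemma pos_lower_bound (R : realFieldType) (T : finType) (f : T -> R) :
  (forall t, 0 < f t) -> exists2 e, 0 < e & forall t, e <= f t.
Proof.
move=> f_gt0.
suff [e e0 He] : exists2 e, 0 < e & forall t, t \in enum T -> e <= f t.
  by exists e => // t; apply: He; rewrite mem_enum.
elim: (enum T) => [|t s [e e0 He]]; first by exists 1.
exists (Num.min e (f t)); first by rewrite lt_min e0 f_gt0.
move=> u; rewrite inE => /orP[/eqP->|/He le_ef]; first by rewrite ge_min lexx orbT.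
by rewrite ge_min le_ef.
Qed.

(* Bartl's induction on the number of generators: a point xh separating c from all
   but the first generator, normalised by a1 xh = 1, is used to project the other
   generators and c along a1. *)
Lemma farkas_cone (R : realFieldType) (N p : nat) (a : 'M[R]_(N, p)) (c : 'rV[R]_p) :
  (exists2 lam : 'rV_N, (forall l, 0 <= lam ord0 l) & c = lam *m a) \/
  (exists2 x : 'cV_p, (forall l, (a *m x) l ord0 <= 0) & 0 < (c *m x) ord0 ord0).
Proof.
elim: N a c => [|N IHN] a c.
  have [->|/matrix0Pn[i [j]]] := eqVneq c 0.
    by left; exists 0 => [[]//|]; rewrite mul0mx.
  rewrite ord1 => cj; right; exists c^T => [[]//|].
  rewrite mxE; under eq_bigr do rewrite mxE -expr2.
  rewrite (bigD1 j) //=; apply: ltr_wpDr.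
    by apply: sumr_ge0 => i0 _; exact: sqr_ge0.
  by rewrite lt_def sqr_ge0 sqrf_eq0 cj.
move: a; rewrite -[N.+1]/(1 + N)%N => a.
rewrite -[a]vsubmxK; set a1 := usubmx a; set a2 := dsubmx a.
case: (IHN a2 c) => [[lam lam0 ->]|[x ax cx]].
  left; exists (row_mx 0 lam) => [l|]; last by rewrite mul_row_col mul0mx add0r.
  by case: (split_ordP l) => j ->; rewrite ?row_mxEl ?row_mxEr ?mxE.
have [a1x|a1x] := lerP ((a1 *m x) ord0 ord0) 0.
  right; exists x => // l; rewrite mul_col_mx.
  by case: (split_ordP l) => j ->; rewrite ?col_mxEu ?col_mxEd ?ord1.
pose s := (a1 *m x) ord0 ord0; pose xh := s^-1 *: x.
have a1xh : a1 *m xh = 1%:M.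
  apply/matrixP=> i j; rewrite !ord1 -scalemxAr mxE [RHS]mxE -/s.
  by rewrite mulVf // gt_eqF.
have axh l : (a2 *m xh) l ord0 <= 0.
  by rewrite -scalemxAr mxE pmulr_rle0 ?invr_gt0.
have cxh : 0 < (c *m xh) ord0 ord0 by rewrite -scalemxAr mxE mulr_gt0 ?invr_gt0.
case: (IHN (a2 - a2 *m xh *m a1) (c - c *m xh *m a1)) => [[lam lam0 Hc]|[y ay cy]].
  (* The first generator takes the weight left over when the projection is undone; it is nonnegative
     because [c *m xh] is positive and all entries of [a2 *m xh] are nonpositive. *)
  left; exists (row_mx (c *m xh - lam *m (a2 *m xh)) lam) => [l|].
    case: (split_ordP l) => j ->; rewrite ?row_mxEl ?row_mxEr //.
    rewrite [j]ord1 [X in 0 <= X]mxE [X in _ + X]mxE subr_ge0.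
    apply: le_trans (ltW cxh); rewrite mxE sumr_le0 // => i _.
    by rewrite mulr_ge0_le0.
  rewrite mul_row_col mulmxBl; move/eqP: Hc; rewrite subr_eq => /eqP {1}->.
  by rewrite mulmxBr !mulmxA addrC addrCA addrC.
(* Correcting [y] along [xh] makes [a1] vanish on it and gives the other generators and [c] the
   values that their projections take at [y]. *)
right; exists (y - xh *m (a1 *m y)).
  have a1z : a1 *m (y - xh *m (a1 *m y)) = 0 by rewrite mulmxBr mulmxA a1xh mul1mx subrr.
  move=> l; rewrite mul_col_mx; case: (split_ordP l) => j ->.
    by rewrite col_mxEu a1z mxE.
  rewrite col_mxEd; move: (ay j); congr (_ <= _); congr ((_ : 'M__) _ _).
  by rewrite mulmxBl mulmxBr !mulmxA.
by rewrite mulmxBr !mulmxA -mulmxBl.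
Qed.

(** The cone is generated by the columns of [M] and the negated unit vectors: the weights of the
    latter are the slacks in $b\le My$, and on the separating side they force $x\ge0$. *)
Lemma farkas_le (R : realFieldType) (q p : nat) (M : 'M[R]_(q, p)) (b : 'cV[R]_q) :
  (exists2 y : 'cV_p, (forall j, 0 <= y j ord0) & forall i, b i ord0 <= (M *m y) i ord0) \/
  (exists x : 'cV_q, [/\ forall i, 0 <= x i ord0, forall j, (M^T *m x) j ord0 <= 0 &
    0 < (b^T *m x) ord0 ord0]).
Proof.
case: (farkas_cone (col_mx M^T (- 1%:M)) b^T) => [[lam lam0 Hb]|[x ax bx]].
  left; exists (lsubmx lam)^T => [j|i]; first by rewrite !mxE.
  move: Hb; rewrite -{1}[lam]hsubmxK mul_row_col mulmxN mulmx1.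
  move=> /matrixP/(_ ord0 i); rewrite -[lsubmx lam]trmxK -trmx_mul.
  rewrite ![in X in X -> _]mxE => ->; rewrite trmxK.
  by rewrite [X in _ <= X]mxE gerDl oppr_le0.
right; exists x; split=> // [i|j].
  by move: (ax (rshift _ i)); rewrite mul_col_mx col_mxEd mulNmx mul1mx mxE oppr_le0.
by move: (ax (lshift _ j)); rewrite mul_col_mx col_mxEu.
Qed.

(** * Affine dimension *)

Section AffineDimension.
Variables (R : realFieldType) (k : nat).
Implicit Types S F : 'cV[R]_k -> Prop.

(** The appended coordinate 1 turns affine dependence of points into linear dependence of rows, so
    that affine independence becomes a rank condition. *)
Definition homogenization N (p : 'I_N -> 'cV[R]_k) : 'M[R]_(N, k + 1) :=
  \matrix_i row_mx (p i)^T 1.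

Lemma homogenizationEl N (p : 'I_N -> 'cV[R]_k) i j :
  homogenization p i (lshift 1 j) = p i j ord0.
Proof. by rewrite mxE row_mxEl mxE. Qed.

Lemma homogenizationEr N (p : 'I_N -> 'cV[R]_k) i :
  homogenization p i (rshift k ord0) = 1.
Proof. by rewrite mxE row_mxEr mxE eqxx. Qed.

Lemma mul_homogenization N (p : 'I_N -> 'cV[R]_k) (lam : 'rV_N) :
  lam *m homogenization p =
  row_mx (\sum_i lam ord0 i *: p i)^T (\sum_i lam ord0 i)%:M.
Proof.
rewrite mulmx_sum_row; under eq_bigr do rewrite rowK scale_row_mx.
apply/matrixP=> i j; rewrite summxE ord1; case: (split_ordP j) => l ->.
  rewrite row_mxEl mxE summxE; apply: eq_bigr => t _; by rewrite row_mxEl !mxE.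
rewrite row_mxEr !ord1 mxE; apply: eq_bigr => t _.
by rewrite row_mxEr !mxE mulr1.
Qed.

Lemma aff_indepP N (p : 'I_N -> 'cV[R]_k) :
  aff_indep p <-> row_free (homogenization p).
Proof.
split=> [p_indep|p_free lam lam0 lamp i].
  apply: inj_row_free => v; rewrite mul_homogenization -row_mx0.
  move=> /eq_row_mx[vp /matrixP/(_ ord0 ord0)]; rewrite !mxE eqxx mulr1n => v0.
  apply/rowP=> i; rewrite mxE; apply: p_indep => //.
  by rewrite -[LHS]trmxK vp trmx0.
have: (\row_i lam i) *m homogenization p = 0.
  rewrite mul_homogenization; under eq_bigr do rewrite mxE.
  rewrite lamp; under eq_bigr do rewrite mxE.
  by rewrite lam0 trmx0 raddf0 row_mx0.
move/(congr1 (fun z => z *m pinvmx (homogenization p))); rewrite mul0mx mulmxKp //.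
by move=> /rowP/(_ i); rewrite !mxE.
Qed.

Lemma aff_indep_inj N N' (f : 'I_N -> 'I_N') (p : 'I_N' -> 'cV[R]_k) :
  injective f -> aff_indep p -> aff_indep (p \o f).
Proof.
move=> f_inj p_indep lam lam0 lamp i.
(* Extension of [lam] by zero along [f]: each fibre has at most one element. *)
pose lam' l := \sum_(i | f i == l) lam i.
have lam'f : lam' (f i) = lam i.
  by rewrite /lam' (big_pred1 i) // => j; rewrite /= (inj_eq f_inj).
rewrite -lam'f; apply: p_indep.
  by rewrite -[RHS]lam0 [RHS](partition_big f xpredT).
rewrite -[RHS]lamp [RHS](partition_big f xpredT) //=; apply: eq_bigr => l _.
by rewrite scaler_suml; apply: eq_bigr => j /eqP <-.
Qed.

(** If two values differed, the larger independent family, cut down to one point more than the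
    smaller one, would contradict the maximality of the latter. *)
Lemma affdim_uniq S d d' : affdim S d -> affdim S d' -> d = d'.
Proof.
case=> [[-> S0]|[N [-> [[p [Sp p_indep]] maxN]]]];
  case=> [[-> S0']|[N' [-> [[p' [Sp' p'_indep]] maxN']]]] //.
- by case: (S0 _ (Sp' ord0)).
- by case: (S0' _ (Sp ord0)).
congr (Posz _); case: (ltngtP N N') => // ltN.
  case: (maxN (p' \o widen_ord (ltN : N.+1 < N'.+1)%N)) => [i|]; first exact: Sp'.
  by apply: aff_indep_inj => // i j /(congr1 val) /= /val_inj.
case: (maxN' (p \o widen_ord (ltN : N'.+1 < N.+1)%N)) => [i|]; first exact: Sp.
by apply: aff_indep_inj => // i j /(congr1 val) /= /val_inj.
Qed.

End AffineDimension.

(** * Bounded polyhedra *)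

Section Polyhedron.
Variables (R : realFieldType) (N k : nat) (W : 'M[R]_(N, k)) (b : 'cV[R]_N).

Definition polyhedron (x : 'cV[R]_k) := forall l, (W *m x) l ord0 <= b l ord0.

Definition tight (x : 'cV[R]_k) : {set 'I_N} :=
  [set l | (W *m x) l ord0 == b l ord0].

Definition tight_on (I : {set 'I_N}) (x : 'cV[R]_k) := polyhedron x /\ I \subset tight x.

(** Coefficients are indexed by all rows and vanish off [I], so that passing to a subset requires no
    reindexing. *)
Definition row_indep (I : {set 'I_N}) :=
  forall lam : 'rV[R]_N, (forall l, l \notin I -> lam ord0 l = 0) ->
    lam *m W = 0 -> lam = 0.

Definition redundant (l : 'I_N) :=
  forall x, (forall l', l' != l -> (W *m x) l' ord0 <= b l' ord0) <-> polyhedron x.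

Definition subrows (I : {set 'I_N}) : 'M[R]_(#|I|, k) := rowsub enum_val W.

Lemma subrows_mul I (w : 'cV[R]_k) i :
  (subrows I *m w) i ord0 = (W *m w) (enum_val i) ord0.
Proof. by rewrite !mxE; apply: eq_bigr => j _; rewrite mxE. Qed.

Lemma row_indepP I : row_indep I <-> row_free (subrows I).
Proof.
split=> [I_indep|I_free lam lam0 lamW].
  apply: inj_row_free => v vW.
  pose lam : 'rV[R]_N := \row_l \sum_(i | enum_val i == l) v ord0 i.
  have lamE i : lam ord0 (enum_val i) = v ord0 i.
    by rewrite mxE (big_pred1 i) // => j; rewrite /= (inj_eq enum_val_inj).
  apply/rowP=> i; rewrite [v]lock mxE -lock -lamE.
  suff -> : lam = 0 by rewrite mxE.
  apply: I_indep => [l l_I|].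
    rewrite mxE big_pred0 // => i'; apply: contraNF l_I => /eqP <-.
    exact: enum_valP.
  rewrite -vW; apply/rowP=> j; rewrite !mxE.
  rewrite [RHS](partition_big enum_val xpredT) //=; apply: eq_bigr => l _.
  by rewrite mxE mulr_suml; apply: eq_bigr => i' /eqP <-; rewrite mxE.
have: (\row_i lam ord0 (enum_val i)) *m subrows I = 0.
  rewrite -lamW; apply/rowP=> j; rewrite !mxE.
  rewrite [RHS](bigID (mem I)) /= [X in _ + X]big1 => [|l /lam0 ->]; last by rewrite mul0r.
  rewrite addr0 [RHS]big_enum_val; apply: eq_bigr => i _; by rewrite !mxE.
move/(congr1 (fun z => z *m pinvmx (subrows I))); rewrite mul0mx mulmxKp // => lamI.
apply/rowP=> l; rewrite [RHS]mxE; have [lI|/lam0//] := boolP (l \in I).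
by move/rowP/(_ (enum_rank_in lI l)): lamI; rewrite !mxE enum_rankK_in.
Qed.

Lemma row_indep_sub (I J : {set 'I_N}) : I \subset J -> row_indep J -> row_indep I.
Proof.
move=> /subsetP sIJ J_indep lam lam0; apply: J_indep => l lJ.
by apply: lam0; apply: contra lJ => /sIJ.
Qed.

Lemma row_indep_card I : row_indep I -> (#|I| <= k)%N.
Proof. by move/row_indepP/eqP <-; exact: rank_leq_col. Qed.

Lemma row_indep1 l : row l W != 0 -> row_indep [set l].
Proof.
move=> Wl lam lam0 lamW; apply/rowP=> l'; rewrite [RHS]mxE.
have [->{l'}|l'l] := eqVneq l' l; last by apply: lam0; rewrite inE.
have: lam ord0 l *: row l W = 0.
  rewrite -lamW mulmx_sum_row (bigD1 l) //= big1 ?addr0 // => i il.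
  by rewrite lam0 ?inE // scale0r.
by move/eqP; rewrite scaler_eq0 (negPf Wl) orbF => /eqP.
Qed.

(** Only the slack inequalities limit the step; how the tight ones behave along [w] is left to each
    use. *)
Lemma small_move x (w : 'cV[R]_k) : polyhedron x -> exists2 e, 0 < e &
  forall l, l \notin tight x -> (W *m (x + e *: w)) l ord0 < b l ord0.
Proof.
move=> Px.
(* The value 1 on tight rows is a filler; the added 1 keeps the denominator positive. *)
pose f l := if l \in tight x then 1 else
  (b l ord0 - (W *m x) l ord0) / (`|(W *m w) l ord0| + 1).
case: (@pos_lower_bound _ _ f) => [l|e e0 He].
  rewrite /f; case: ifPn => // lx; apply: divr_gt0; last by rewrite ltr_wpDl.
  rewrite subr_gt0.
  by rewrite lt_def Px andbT eq_sym; rewrite inE in lx.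
exists e => // l lx; move: (He l); rewrite /f (negPf lx).
rewrite ler_pdivlMr ?ltr_wpDl // lerBrDl => le_b; apply: lt_le_trans le_b.
rewrite mulmxDr -scalemxAr mxE ltrD2l mxE ltr_pM2l //.
by rewrite (le_lt_trans (ler_norm _)) ?ltrDl.
Qed.

Hypothesis Pbounded : bounded_set polyhedron.

Lemma bounded_direction x (w : 'cV[R]_k) :
  (forall t, 0 <= t -> polyhedron (x + t *: w)) -> w = 0.
Proof.
case: Pbounded => M HM Pt; apply/colP=> i; rewrite [RHS]mxE; apply/eqP/negP=> /negP wi.
have HMt t : 0 <= t -> `|t * w i ord0| <= M + `|x i ord0|.
  move=> t0; move: (HM _ (Pt t t0) i); rewrite mxE [X in _ + X]mxE => le_M.
  rewrite -[X in `|X|](addKr (x i ord0)) (le_trans (ler_normD _ _)) //.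
  by rewrite normrN addrC lerD2r.
have M0 : 0 <= M + `|x i ord0| by rewrite (le_trans _ (HMt 0 (lexx _))).
have M1 : 0 <= M + `|x i ord0| + 1 by exact: addr_ge0.
(* This step length moves coordinate [i] by $M+|x_i|+1$, more than boundedness allows. *)
move: (HMt _ (divr_ge0 M1 (normr_ge0 (w i ord0)))).
rewrite normrM normf_div normr_id divfK ?normr_eq0 // ger0_norm //.
by rewrite leNgt ltrDl ltr01.
Qed.

(** By boundedness some row increases along [w], and the minimum ratio test stops at the first such
    row to become tight. Rows tight at [x] stay tight because they are constant along [w]. *)
Lemma ray_exit x (w : 'cV[R]_k) : polyhedron x -> w != 0 ->
  (forall l, l \in tight x -> (W *m w) l ord0 = 0) ->
  exists2 y, polyhedron y & tight x \proper tight y.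
Proof.
move=> Px w0 wI.
have [l0 Wl0] : exists l, 0 < (W *m w) l ord0.
  apply/existsP; apply: contra_neqT w0; rewrite negb_exists => /forallP Wle.
  apply: (@bounded_direction x) => t t0 l; rewrite mulmxDr -scalemxAr mxE [X in _ + X]mxE.
  by rewrite -[leRHS]addr0 lerD // mulr_ge0_le0 // leNgt.
pose r l := (b l ord0 - (W *m x) l ord0) / (W *m w) l ord0.
case: (@arg_minP _ _ _ l0 (fun l => 0 < (W *m w) l ord0) r Wl0) => l Wl rmin.
have r0 : 0 <= r l by rewrite divr_ge0 ?(ltW Wl) // subr_ge0.
exists (x + r l *: w) => [l'|].
  rewrite mulmxDr -scalemxAr mxE [X in _ + X]mxE.
  have [Wl'|Wl'] := ltrP 0 ((W *m w) l' ord0).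
    rewrite -lerBrDl -ler_pdivlMr //; exact: rmin.
  by rewrite -[leRHS]addr0 lerD // mulr_ge0_le0.
apply/properP; split.
  apply/subsetP=> l' l'x; move: (l'x); rewrite !inE => /eqP <-.
  by rewrite mulmxDr -scalemxAr mxE [X in _ + X]mxE (wI _ l'x) mulr0 addr0.
exists l; last by apply: contraL Wl => /wI /= ->; rewrite ltxx.
rewrite inE mulmxDr -scalemxAr mxE [X in _ + X]mxE divfK; last by rewrite gt_eqF.
by rewrite addrC subrK.
Qed.

(* While the tight rows do not span, moving along their kernel makes a further
   inequality tight; at the resulting vertex, k tight rows must be independent. *)
Lemma tight_row_indep x : (forall y, polyhedron y -> #|tight y| <= k)%N ->
  polyhedron x -> row_indep (tight x).
Proof.
move=> tight_le; have [j] := ubnP (N - #|tight x|)%N.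
elim: j x => // j IHj x; rewrite ltnS => le_j Px.
have [full|not_full] := boolP (row_full (subrows (tight x))).
  apply/row_indepP; rewrite /row_free eqn_leq rank_leq_row /=.
  by move/eqP: full => ->; exact: tight_le.
have: cokermx (subrows (tight x)) != 0.
  rewrite -mxrank_eq0 mxrank_coker subn_eq0 -ltnNge ltn_neqAle rank_leq_col andbT.
  exact: not_full.
case/matrix0Pn=> i [j' cij].
have Ww : subrows (tight x) *m col j' (cokermx (subrows (tight x))) = 0.
  by rewrite colE mulmxA mulmx_coker mul0mx.
have w0 : col j' (cokermx (subrows (tight x))) != 0.
  by apply: contra_neq cij => /colP/(_ i); rewrite !mxE.
case: (ray_exit Px w0) => [l lx|y Py ltxy].
  by rewrite -(enum_rankK_in lx lx) -subrows_mul Ww mxE.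
(* Independence at [y] passes down to the smaller tight set at [x]; the number of slack rows is the
   induction measure. *)
apply: row_indep_sub (proper_sub ltxy) _; apply: IHj => //.
apply: leq_trans le_j; rewrite ltn_sub2l ?proper_card //.
by rewrite (leq_trans (proper_card ltxy)) // -[X in (_ <= X)%N]card_ord max_card.
Qed.


(** Small moves from [x] along a basis of the kernel of the tight rows stay in the face and,
    together with [x], give enough independent points. Conversely, homogenized points of the face
    are annihilated by the tight rows extended by the negated right-hand sides, which bounds their
    rank. *)
Lemma affdim_tight_on x : polyhedron x -> row_indep (tight x) ->
  affdim (tight_on (tight x)) (k%:Z - #|tight x|%:Z).
Proof.
move=> Px x_indep; have I_le := row_indep_card x_indep.
move/row_indepP: x_indep; set WI := subrows (tight x) => WI_free.
have rkK : \rank (kermx WI^T) = (k - #|tight x|)%N.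
  by rewrite mxrank_ker mxrank_tr (eqP WI_free).
pose w i : 'cV_k := (row i (row_base (kermx WI^T)))^T.
have Ww i l : l \in tight x -> (W *m w i) l ord0 = 0.
  move=> lx; rewrite -(enum_rankK_in lx lx) -subrows_mul -/WI.
  rewrite -[WI]trmxK -trmx_mul -row_mul.
  have /sub_kermxP -> : (row_base (kermx WI^T) <= kermx WI^T)%MS by rewrite eq_row_base.
  by rewrite row0 !mxE.
have eW i : exists2 e, 0 < e & tight_on (tight x) (x + e *: w i).
  have [e e0 He] := small_move (w i) Px; exists e => //.
  have tightE l : l \in tight x -> (W *m (x + e *: w i)) l ord0 = b l ord0.
    move=> lx; rewrite mulmxDr -scalemxAr mxE [X in _ + X]mxE Ww // mulr0 addr0.
    by move: lx; rewrite inE => /eqP.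
  split; last by apply/subsetP=> l /tightE lx; rewrite inE lx.
  by move=> l; have [/tightE->|/He/ltW] := boolP (l \in tight x).
have {eW} [e e0 He2] := fin_all_exists2 eW.
right; exists (\rank (kermx WI^T)); split; first by rewrite rkK subzn.
split.
  exists (fun i => if unlift ord0 i is Some j then x + e j *: w j else x).
  split=> [i|lam].
    by case: unliftP => [j _|_]; [exact: He2|split].
  rewrite !big_ord_recl unlift_none => lam0 lamp.
  have lamw : \row_i (lam (lift ord0 i) * e i) *m row_base (kermx WI^T) = 0.
    rewrite mulmx_sum_row -[RHS]trmx0 -lamp; apply: trmx_inj; rewrite trmxK.
    rewrite linear_sum /=.
    under [in RHS]eq_bigr do rewrite liftK scalerDr.
    rewrite big_split /= -scaler_suml addrA -scalerDl lam0 scale0r add0r.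
    by apply: eq_bigr => i _; rewrite scalerA linearZ mxE.
  have {}lamw i : lam (lift ord0 i) = 0.
    move/(congr1 (fun z => z *m pinvmx (row_base (kermx WI^T)))): lamw.
    rewrite mul0mx mulmxKp ?row_base_free // => /rowP/(_ i); rewrite !mxE => /eqP.
    by rewrite mulf_eq0 (gt_eqF (e0 i)) orbF => /eqP.
  move=> i; case: (unliftP ord0 i) => [j ->|->] //.
  by move: lam0; rewrite big1 ?addr0.
move=> p Fp /aff_indepP p_free.
have := mulmx0_rank_max (m := (\rank (kermx WI^T)).+2) (p := #|tight x|)
  (A := homogenization p) (B := (row_mx WI (- \col_i b (enum_val i) ord0))^T).
rewrite mxrank_tr (eqP p_free) => rk_le.
suff: ((\rank (kermx WI^T)).+2 + #|tight x| <= k + 1)%N.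
  by rewrite rkK !addSn subnK // addn1 ltnn.
suff rkV : \rank (row_mx WI (- \col_i b (enum_val i) ord0)) = #|tight x|.
  rewrite -[X in (_ + X <= _)%N]rkV; apply: rk_le; apply/matrixP=> i j; rewrite [RHS]mxE.
  rewrite mxE big_split_ord /= big_ord1.
  have [_ /subsetP/(_ _ (enum_valP j))] := Fp i; rewrite inE => /eqP.
  rewrite -subrows_mul => Wp; rewrite homogenizationEr mul1r [X in _ + X]mxE row_mxEr.
  rewrite [X in _ + X]mxE [X in _ - X]mxE -Wp mxE; apply/eqP; rewrite subr_eq0; apply/eqP.
  by apply: eq_bigr => l _; rewrite homogenizationEl mxE row_mxEl mulrC.
apply/eqP; rewrite -[_ == _]/(row_free _); apply: inj_row_free => v.
rewrite mul_mx_row -row_mx0 => /eq_row_mx[+ _].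
by move/(congr1 (fun z => z *m pinvmx WI)); rewrite mul0mx mulmxKp.
Qed.

End Polyhedron.

(** * Polyhedra with an interior point: facets and redundancy *)

Section FullDimensional.
Variables (R : realFieldType) (N k : nat) (W : 'M[R]_(N, k)) (b : 'cV[R]_N).
Variable x0 : 'cV[R]_k.
Hypothesis x0_strict : forall l, (W *m x0) l ord0 < b l ord0.

Local Notation P := (polyhedron W b).

Let Px0 : P x0. Proof. by move=> l; apply: ltW. Qed.

(** No inequality is tight at [x0], so this is the face dimension formula for an empty tight set. *)
Lemma affdim_polyhedron : affdim P k%:Z.
Proof.
have tx0 : tight W b x0 = set0.
  by apply/setP=> l; rewrite !inE lt_eqF.
have := affdim_tight_on Px0; rewrite tx0 cards0 subr0.
have -> : tight_on W b set0 = P; last first.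
  by apply=> lam lam0 _; apply/rowP=> l; rewrite mxE lam0 ?inE.
apply: functional_extensionality => x; apply: propositional_extensionality.
by rewrite /tight_on sub0set; split=> [[]|].
Qed.

(** A zero row has value 0 everywhere, so it cannot be tight at [x] and strict at [x0]. *)
Lemma tight_row_neq0 l x : l \in tight W b x -> row l W != 0.
Proof.
rewrite inE => /eqP Wx; apply: contraTneq (x0_strict l) => Wl.
suff W0 (y : 'cV[R]_k) : (W *m y) l ord0 = 0 by rewrite -Wx !W0 ltxx.
have -> : (W *m y) l ord0 = (row l W *m y) ord0 ord0.
  by rewrite -row_mul [in RHS]mxE.
by rewrite Wl mul0mx mxE.
Qed.

(* The k points spanning the facet F have a common tight inequality l: otherwise
   their barycenter would be interior, and c would vanish. The hyperplanes of c
   and of l then share k affinely independent points, hence coincide. *)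
Lemma facet_tight F z : facet_of P F -> F z ->
  exists l, forall y, F y <-> (P y /\ l \in tight W b y).
Proof.
move=> [d [Pd [[c [c0 [Pc Fc]]] Fd]]] Fz.
have {Pd}dk : d = k%:Z by apply: affdim_uniq Pd affdim_polyhedron.
have c_neq0 : c != 0.
  (* With [c] zero, [F] would be all of [P], of dimension both $k$ and $k-1$. *)
  apply/eqP=> c00; have FP : F = P.
    apply: functional_extensionality => x; apply: propositional_extensionality.
    have [Pz cz] := (Fc z).1 Fz; split=> [/Fc[]//|Px]; apply/Fc; split=> //.
    by rewrite -cz c00 trmx0 !mul0mx.
  move: Fd; rewrite FP => /(affdim_uniq affdim_polyhedron); rewrite -dk.
  by move/eqP; rewrite -subr_eq0 opprB addrC subrK.
case: Fd => [[_ /(_ _ Fz)//]|[K [dK [[p [Fp p_indep]] _]]]].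
have kK : k = K.+1 by apply/eqP; rewrite -eqz_nat -dk -addn1 PoszD -dK subrK.
have [/existsP[l /forallP lp]|] :=
  boolP [exists l, [forall i, l \in tight W b (p i)]]; last first.
  rewrite negb_exists => /forallP none.
  pose q := K.+1%:R^-1 *: \sum_i p i.
  have Wq l : (W *m q) l ord0 < b l ord0.
    rewrite -scalemxAr mxE mulrC ltr_pdivrMr ?ltr0Sn // mulmx_sumr summxE.
    rewrite mulr_natr -[X in _ *+ X]card_ord -sumr_const.
    have /forallPn[i li] := none l.
    rewrite (bigD1 i) //= [X in _ < X](bigD1 i) //= ltr_leD //.
      have [Pi _] := (Fc _).1 (Fp i).
      by rewrite lt_def Pi andbT eq_sym; rewrite inE in li.
    by apply: ler_sum => j _; have [] := (Fc _).1 (Fp j).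
  have cq : (c^T *m q) ord0 ord0 = c0.
    rewrite -scalemxAr mxE mulmx_sumr summxE.
    under eq_bigr => i _ do rewrite ((Fc _).1 (Fp i)).2.
    by rewrite sumr_const card_ord -[c0 *+ _]mulr_natr mulrC mulfK ?pnatr_eq0.
  move: q Wq cq => q Wq cq.
  (* A small move from the interior point [q] along [c] stays in [P] and so cannot exceed the
     maximum [c0]; hence $c^\top c\le0$. *)
  have [|e e0 He] := @small_move _ _ _ W b q c; first by move=> l; apply: ltW.
  have Pqe : P (q + e *: c).
    by move=> l; apply/ltW/He; rewrite inE lt_eqF.
  have := Pc _ Pqe; rewrite mulmxDr -scalemxAr mxE cq [X in _ + X]mxE gerDl.
  rewrite pmulr_rle0 // mxE => cc.
  case/negP: c_neq0; apply/eqP/colP=> i; rewrite [RHS]mxE; apply/eqP.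
  rewrite -sqrf_eq0 eq_le sqr_ge0 andbT (le_trans _ cc) //.
  rewrite (bigD1 i) //= mxE -expr2 lerDl sumr_ge0 // => j _.
  by rewrite mxE -expr2 sqr_ge0.
exists l; have Wl := tight_row_neq0 (lp ord0).
(* Homogenized equations of the two hyperplanes; both annihilate every [p i]. *)
pose u := row_mx (row l W) (- b l ord0)%:M : 'rV_(k + 1).
pose v := row_mx c^T (- c0)%:M : 'rV_(k + 1).
have dotE (w : 'rV_k) (w0 : R) (y : 'cV_k) :
    (row_mx w w0%:M *m col_mx y 1%:M) ord0 ord0 = (w *m y) ord0 ord0 + w0.
  by rewrite mul_row_col mulmx1 mxE [X in _ + X]mxE eqxx mulr1n.
have rowE (y : 'cV_k) : (row l W *m y) ord0 ord0 = (W *m y) l ord0.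
  by rewrite -row_mul mxE.
have homE i : row i (homogenization p) = (col_mx (p i) 1%:M)^T.
  by rewrite rowK tr_col_mx trmx1.
have in_ker (w : 'rV_(k + 1)) :
    (forall i, (w *m col_mx (p i) 1%:M) ord0 ord0 = 0) ->
    (w <= kermx (homogenization p)^T)%MS.
  move=> w0; apply/sub_kermxP; apply: trmx_inj; rewrite trmx_mul trmxK trmx0.
  apply/row_matrixP=> i; rewrite row_mul homE -trmx_mul row0; apply/matrixP=> r s.
  by rewrite !ord1 mxE w0 mxE.
have u_ker : (u <= kermx (homogenization p)^T)%MS.
  apply: in_ker => i; rewrite dotE rowE; apply/eqP; rewrite subr_eq0.
  by have := lp i; rewrite inE.
have v_ker : (v <= kermx (homogenization p)^T)%MS.
  by apply: in_ker => i; rewrite dotE ((Fc _).1 (Fp i)).2 subrr.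
have u_neq0 : u != 0.
  by apply: contra_neq Wl => /eqP; rewrite row_mx_eq0 => /andP[/eqP].
(* The $k$ independent points leave a kernel of dimension $k+1-k=1$, which [u] spans. *)
have [a va] : exists a, v = a *: u.
  apply/sub_rVP; apply: submx_trans v_ker _.
  rewrite -(mxrank_leqif_sup u_ker) rank_rV u_neq0 mxrank_ker mxrank_tr.
  by move/aff_indepP/eqP: p_indep => ->; rewrite {1}kK addn1 subSnn.
have [ca _] : c^T = a *: row l W /\ (- c0)%:M = a *: (- b l ord0)%:M :> 'M_1.
  by apply: eq_row_mx; rewrite -scale_row_mx.
have a0 : a != 0.
  by apply: contra_neq c_neq0 => a0; apply: trmx_inj; rewrite ca a0 scale0r trmx0.
have va_y (y : 'cV_k) : (c^T *m y) ord0 ord0 - c0 = a * ((W *m y) l ord0 - b l ord0).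
  by rewrite -dotE -/v va -scalemxAl mxE dotE rowE.
move=> y; rewrite inE; apply: iff_trans (Fc y) _.
split=> -[Py cy]; split=> //.
  move: (va_y y); rewrite cy subrr => /esym/eqP.
  by rewrite mulf_eq0 (negPf a0) subr_eq0.
move: (va_y y); rewrite (eqP cy) subrr mulr0 => /eqP; rewrite subr_eq0.
by move/eqP.
Qed.

(** Each facet through a point is cut out by an inequality tight there, and distinct facets need
    distinct inequalities, so the bound on tight inequalities bounds the facets. *)
Lemma simple_polyhedron : bounded_set P ->
  (forall x, P x -> #|tight W b x| <= k)%N -> simple_polytope P.
Proof.
move=> Pb tight_le; split=> // D PD z Pz F Ffacet F_neq Fz.
have [Dk] := affdim_uniq PD affdim_polyhedron.
have [l Fl] := fin_all_exists (fun i => facet_tight (Ffacet i) (Fz i)).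
have l_inj : injective l.
  move=> i j lij; apply/eqP/negP=> /negP /F_neq; apply=> y.
  by apply: iff_trans (Fl i y) _; rewrite lij; apply: iff_sym (Fl j y).
have := tight_le _ Pz; rewrite -[X in (_ <= X)%N]Dk leqNgt => /negP; apply.
rewrite -[X in (X <= _)%N]card_ord -(card_imset _ l_inj) subset_leq_card //.
by apply/subsetP=> _ /imsetP[i _ ->]; have [] := (Fl i z).1 (Fz i).
Qed.

(** Independence gives a direction that increases row [l] and keeps the other tight rows constant; a
    small move along it violates [l] alone. *)
Lemma binding_not_redundant l x : P x -> row_indep W (tight W b x) ->
  redundant W b l -> l \notin tight W b x.
Proof.
move=> Px /row_indepP/row_freeP[E WE] l_red; apply/negP=> lx.
(* The column for [l] of a right inverse of the tight rows: $Ww$ is 1 at [l] and 0 at the other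
   tight rows. *)
pose w := col (enum_rank_in lx l) E.
have Ww l' : l' \in tight W b x -> (W *m w) l' ord0 = (l' == l)%:R.
  move=> l'x; rewrite -(enum_rankK_in lx l'x) -subrows_mul /w colE mulmxA WE mul1mx.
  rewrite mxE eqxx andbT; congr (nat_of_bool _)%:R.
  by rewrite -(inj_eq enum_val_inj) !enum_rankK_in.
have [e e0 He] := small_move w Px.
have Wxe l' : (W *m (x + e *: w)) l' ord0 = (W *m x) l' ord0 + e * (W *m w) l' ord0.
  by rewrite mulmxDr -scalemxAr mxE [X in _ + X]mxE.
have : P (x + e *: w).
  apply/l_red => l' l'l; have [l'x|/He/ltW//] := boolP (l' \in tight W b x).
  by rewrite Wxe Ww // (negPf l'l) mulr0 addr0.
move/(_ l); rewrite Wxe Ww // eqxx mulr1; move: (lx); rewrite inE => /eqP ->.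
by rewrite gerDl leNgt e0.
Qed.

(* Walk from the interior point x0 to a point violating only l, and stop at l. *)
Lemma not_redundant_tight l : ~ redundant W b l ->
  exists2 y, P y & tight W b y = [set l].
Proof.
move=> l_nred.
have [x [Wx Wlx]] : exists x : 'cV[R]_k, (forall l', l' != l -> (W *m x) l' ord0 <= b l' ord0) /\
    b l ord0 < (W *m x) l ord0.
  apply: NNPP => no_x; apply: l_nred => x; split=> [Wx l'|Px l' _]; last exact: Px.
  have [->|/Wx//] := eqVneq l' l; rewrite leNgt; apply/negP=> Wlx.
  by apply: no_x; exists x.
pose dl := (W *m x) l ord0 - (W *m x0) l ord0.
have dl0 : 0 < dl by rewrite subr_gt0 (lt_trans (x0_strict l)).
(* The parameter at which the segment from [x0] to [x] meets the hyperplane of [l]; as it is below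
   1, the weight of [x0] keeps the other inequalities strict. *)
pose s := (b l ord0 - (W *m x0) l ord0) / dl.
have s1 : s < 1 by rewrite ltr_pdivrMr // mul1r ltrD2r.
have s0 : 0 < s by rewrite divr_gt0 // subr_gt0.
have WE l' : (W *m ((1 - s) *: x0 + s *: x)) l' ord0 =
    (1 - s) * (W *m x0) l' ord0 + s * (W *m x) l' ord0.
  by rewrite mulmxDr -!scalemxAr mxE [X in X + _]mxE [X in _ + X]mxE.
have Wl : (W *m ((1 - s) *: x0 + s *: x)) l ord0 = b l ord0.
  have sE : s * dl = b l ord0 - (W *m x0) l ord0 by rewrite divfK ?gt_eqF.
  by rewrite WE mulrBl mul1r -addrA addrC [_ + s * _]addrC -mulrBr -/dl sE subrK.
have Wl' l' : l' != l -> (W *m ((1 - s) *: x0 + s *: x)) l' ord0 < b l' ord0.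
  move=> l'l; rewrite WE -[X in _ < X]mul1r -[X in X * b _ _](subrK s) [X in _ < X]mulrDl.
  by rewrite ltr_leD ?ltr_pM2l ?subr_gt0 // ler_pM2l // Wx.
exists ((1 - s) *: x0 + s *: x).
  by move=> l'; have [->|/Wl'/ltW//] := eqVneq l' l; rewrite Wl.
apply/setP=> l'; rewrite !inE; have [->|/Wl'/lt_eqF//] := eqVneq l' l.
by rewrite Wl eqxx.
Qed.

(** Among $k+1$ inequalities tight at [x], none would be redundant, so each would define a facet
    through [x], its dimension $k-1$ being computed at a point where it alone is tight. Such points
    also tell the facets apart, against simplicity. *)
Lemma simple_irredundant_tight_card :
  simple_polytope P -> (forall l, redundant W b l -> forall x, P x -> l \notin tight W b x) ->
  forall x, P x -> (#|tight W b x| <= k)%N.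
Proof.
move=> [_ P_simple] irred x Px; rewrite leqNgt; apply/negP=> lt_k.
pose f (i : 'I_k.+1) := enum_val (widen_ord lt_k i).
have f_inj : injective f by move=> i j /enum_val_inj/(congr1 val)/= /val_inj.
have fx i : f i \in tight W b x by exact: enum_valP.
have nred i : ~ redundant W b (f i) by move=> /irred/(_ x Px); rewrite fx.
have [y Py ty] := fin_all_exists2 (fun i => not_redundant_tight (nred i)).
pose F i := tight_on W b [set f i].
apply: (P_simple k affdim_polyhedron x Px F) => [i|i j ij FE|i].
- exists k%:Z; split; first exact: affdim_polyhedron.
  have Wi := tight_row_neq0 (fx i); split.
    exists (row (f i) W)^T, (b (f i) ord0); rewrite trmxK.
    have rowE (z : 'cV_k) : (row (f i) W *m z) ord0 ord0 = (W *m z) (f i) ord0.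
      by rewrite -row_mul mxE.
    split=> z; rewrite ?rowE; first by move=> /(_ (f i)).
    by rewrite /F /tight_on sub1set inE; split=> -[? /eqP].
  have := @affdim_tight_on _ _ _ W b (y i) (Py i).
  by rewrite ty cards1; apply; exact: row_indep1.
- have: F i (y i) by split; rewrite ?ty.
  by move/FE => -[_]; rewrite ty sub1set inE (inj_eq f_inj) eq_sym (negPf ij).
by split; rewrite // sub1set.
Qed.

End FullDimensional.

(** * Best-response polyhedra *)

Lemma card_ord_split (m n : nat) (S : {set 'I_(m + n)}) :
  (#|S| = #|[set i | lshift n i \in S]| + #|[set j | rshift m j \in S]|)%N.
Proof.
by rewrite -!sum1_card big_split_ord /=; congr addn; apply: eq_bigl => i; rewrite inE.
Qed.

Section BestResponsePolyhedron.
Variables (R : realFieldType) (q p : nat) (M : 'M[R]_(q, p)).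

Definition binding (y : 'cV[R]_p) : {set 'I_q} := [set i | (M *m y) i ord0 == 1].

(** The order of the blocks agrees with the encoding of labels, so that labels are exactly the
    indices of tight rows. *)
Definition ineq_mx : 'M[R]_(q + p, p) := col_mx M (- 1%:M).
Definition ineq_rhs : 'cV[R]_(q + p) := col_mx (const_mx 1) 0.

Lemma ineq_mxEl y i : (ineq_mx *m y) (lshift p i) ord0 = (M *m y) i (ord0 : 'I_1).
Proof. by rewrite mul_col_mx col_mxEu. Qed.

Lemma ineq_mxEr y j : (ineq_mx *m y) (rshift q j) ord0 = - y j (ord0 : 'I_1).
Proof. by rewrite mul_col_mx col_mxEd mulNmx mul1mx mxE. Qed.

Lemma ineq_rhsEl i : ineq_rhs (lshift p i) ord0 = 1.
Proof. by rewrite col_mxEu mxE. Qed.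

Lemma ineq_rhsEr j : ineq_rhs (rshift q j) ord0 = 0.
Proof. by rewrite col_mxEd mxE. Qed.

Definition ineqE := (ineq_mxEl, ineq_mxEr, ineq_rhsEl, ineq_rhsEr).

Lemma ineqQE l y : ineqQ M l y = ((ineq_mx *m y) l ord0 <= ineq_rhs l ord0).
Proof.
rewrite /ineqQ; case: split_ordP => j ->; rewrite !ineqE //.
by rewrite oppr_le0.
Qed.

Lemma inQE : inQ M = polyhedron ineq_mx ineq_rhs.
Proof.
apply: functional_extensionality => y; apply: propositional_extensionality.
split=> [[My y0] l|Py].
  by rewrite -ineqQE /ineqQ; case: split_ordP => j _.
split=> i; first by have := Py (lshift p i); rewrite !ineqE.
by have := Py (rshift q i); rewrite !ineqE oppr_le0.
Qed.

Lemma inQ0 : inQ M 0.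
Proof. by split=> i; rewrite ?mulmx0 mxE ?ler01. Qed.

Lemma labelsQE y : labelsQ M y = tight ineq_mx ineq_rhs y.
Proof.
apply/setP=> l; rewrite !inE; case: split_ordP => j ->; rewrite !ineqE //.
by rewrite oppr_eq0.
Qed.

Lemma QJE J : QJ M J = tight_on ineq_mx ineq_rhs J.
Proof.
apply: functional_extensionality => y.
by rewrite /QJ /tight_on labelsQE inQE.
Qed.

Lemma redundantQE l : redundantQ M l <-> redundant ineq_mx ineq_rhs l.
Proof.
rewrite /redundantQ /redundant inQE.
by split=> red x; rewrite -red; split=> H l' /H; rewrite ineqQE.
Qed.

Lemma labelsYE y y' : bestresp_y M y = binding y' -> supp y = supp y' ->
  (forall j, 0 <= y j ord0) -> (forall j, 0 <= y' j ord0) ->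
  labelsY M y = labelsQ M y'.
Proof.
move=> best_y supp_y y0 y'0; apply/setP=> l; rewrite !inE.
case: split_ordP => j _; first by rewrite best_y inE.
move/setP/(_ j): supp_y; rewrite !inE !lt_def y0 y'0 !andbT.
by move/negb_inj.
Qed.

Lemma labelsQ_lshift i y : (lshift p i \in labelsQ M y) = (i \in binding y).
Proof.
by rewrite !inE; case: split_ordP => j => [/lshift_inj ->//|/eqP]; rewrite eq_lrshift.
Qed.

Lemma labelsQ_rshift j y : (rshift q j \in labelsQ M y) = (y j ord0 == 0).
Proof.
by rewrite !inE; case: split_ordP => i => [/eqP|/rshift_inj ->//]; rewrite eq_rlshift.
Qed.

Lemma card_labelsQ y :
  (#|labelsQ M y| = #|binding y| + #|[set j | y j ord0 == 0%R]|)%N.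
Proof.
rewrite card_ord_split; congr (_ + _)%N; apply: eq_card => i.
  by rewrite inE labelsQ_lshift.
by rewrite [LHS]inE [RHS]inE labelsQ_rshift.
Qed.

Lemma card_zeros (y : 'cV[R]_p) : (forall j, 0 <= y j ord0) ->
  #|[set j | y j ord0 == 0]| = (p - #|supp y|)%N.
Proof.
move=> y0; have -> : [set j | y j ord0 == 0] = ~: supp y.
  by apply/setP=> j; rewrite !inE lt_def y0 andbT negbK.
by rewrite cardsCs setCK card_ord.
Qed.

Lemma labelsQ_le y : inQ M y -> (#|labelsQ M y| <= p)%N = (#|binding y| <= #|supp y|)%N.
Proof.
move=> [_ y0]; rewrite card_labelsQ card_zeros // addnBA; last first.
  by rewrite -[X in (_ <= X)%N]card_ord max_card.
by rewrite leq_subLR leq_add2r.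
Qed.

(** The unit rows of the zero coordinates can cancel anything outside the support, so only the
    columns in the support constrain the coefficients of the payoff rows. *)
Lemma row_indep_labelsQ y : inQ M y ->
  row_indep ineq_mx (labelsQ M y) <-> rows_indep M (binding y) (supp y).
Proof.
move=> [_ y0].
have rE j : (rshift q j \in labelsQ M y) = (j \notin supp y).
  by rewrite labelsQ_rshift inE lt_def y0 andbT negbK.
have mulE (mu : 'rV_q) (nu : 'rV_p) j :
    (row_mx mu nu *m ineq_mx) ord0 j = (mu *m M) ord0 j - nu ord0 j.
  by rewrite mul_row_col mulmxN mulmx1 mxE [X in _ + X]mxE.
split=> [indep lam lamM i iJ|indep lam].
  (* The coefficients [mu *m M] of the unit rows complete [mu] to a dependence of all binding rows;
     they vanish on the support by assumption. *)
  pose mu := \row_i (if i \in binding y then lam i else 0).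
  suff: row_mx mu (mu *m M) = 0.
    by move/rowP/(_ (lshift p i)); rewrite row_mxEl !mxE iJ.
  apply: indep => [l|]; last by apply/rowP=> j; rewrite mulE subrr mxE.
  case: (split_ordP l) => j ->; rewrite ?labelsQ_lshift ?rE ?row_mxEl ?row_mxEr => lj.
    by rewrite mxE (negPf lj).
  rewrite -[RHS](lamM j); last by move: lj; rewrite negbK.
  rewrite mxE [RHS]big_mkcond /=; apply: eq_bigr => i' _; rewrite mxE.
  by case: ifP; rewrite // mul0r.
rewrite -[lam]hsubmxK; set mu := lsubmx lam; set nu := rsubmx lam.
move=> lam0 /rowP lamW.
have mu0 i : i \notin binding y -> mu ord0 i = 0.
  by move=> iJ; have := lam0 (lshift p i); rewrite labelsQ_lshift row_mxEl; apply.
have nu0 j : j \in supp y -> nu ord0 j = 0.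
  by move=> iJ; have := lam0 (rshift q j); rewrite rE negbK row_mxEr; apply.
have nuE j : (mu *m M) ord0 j = nu ord0 j.
  by apply/eqP; rewrite -subr_eq0 -mulE lamW mxE.
have {mu0} mu0 : mu = 0.
  apply/rowP=> i; rewrite [RHS]mxE.
  have [iJ|/mu0//] := boolP (i \in binding y).
  apply: (indep (fun i => mu ord0 i)) => // j jy.
  rewrite -[RHS](nu0 j jy) -nuE [RHS]mxE [RHS](bigID (mem (binding y))) /=.
  rewrite [X in _ + X]big1 => [|i' /mu0 ->]; last by rewrite mul0r.
  by rewrite addr0.
rewrite mu0 (_ : nu = 0) ?row_mx0 //; apply/rowP=> j.
by rewrite -nuE mu0 mul0mx.
Qed.

Hypothesis Qbounded : bounded_set (inQ M).

(** At the origin only $y\ge0$ is tight, and a small step along the all-ones vector makes it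
    strict. *)
Lemma inQ_interior : exists y : 'cV[R]_p, forall l, (ineq_mx *m y) l ord0 < ineq_rhs l ord0.
Proof.
have := inQ0; rewrite inQE => P0.
have [e e0 He] := small_move (const_mx 1 : 'cV_p) P0.
exists (0 + e *: const_mx 1) => l; have [|/He//] := boolP (l \in tight ineq_mx ineq_rhs 0).
rewrite -labelsQE inE; case: split_ordP => j ->; rewrite ?mulmx0 mxE.
  by rewrite eq_sym oner_eq0.
by rewrite !ineqE add0r !mxE mulr1 oppr_lt0.
Qed.

(** Otherwise the whole ray through [y] would lie in the bounded set $Q$. *)
Lemma payoff_pos (y : 'cV[R]_p) : (forall j, 0 <= y j ord0) -> y != 0 ->
  exists i, 0 < (M *m y) i ord0.
Proof.
move=> y0 y_neq0; apply/existsP; apply: contra_neqT y_neq0.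
rewrite negb_exists => /forallP My.
have Pb : bounded_set (polyhedron ineq_mx ineq_rhs) by rewrite -inQE.
apply: (bounded_direction Pb (x := 0)) => t t0; rewrite -inQE add0r.
split=> [i|j]; last by rewrite mxE mulr_ge0.
by rewrite -scalemxAr mxE (le_trans _ ler01) // mulr_ge0_le0 // leNgt.
Qed.

Lemma simplex_neq0 (y : 'cV[R]_p) : inSimplex y -> y != 0.
Proof.
move=> [_ y1]; apply: contra_eq_neq y1 => ->.
by rewrite big1 => [|i _]; rewrite ?mxE // eq_sym oner_eq0.
Qed.

Lemma supp_scale s (y : 'cV[R]_p) : 0 < s -> supp (s *: y) = supp y.
Proof. by move=> s0; apply/setP=> j; rewrite !inE mxE pmulr_rgt0. Qed.

Lemma bestresp_scale s y : 0 < s -> bestresp_y M (s *: y) = bestresp_y M y.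
Proof.
move=> s0; apply/setP=> j; rewrite !inE; apply: eq_forallb => i.
by rewrite -!scalemxAr [X in X <= _]mxE [X in _ <= X]mxE ler_pM2l.
Qed.

Lemma bestresp_binding y i : inQ M y -> i \in binding y -> bestresp_y M y = binding y.
Proof.
move=> [My _]; rewrite inE => /eqP Myi; apply/setP=> j; rewrite !inE.
apply/forallP/eqP=> [/(_ i)|-> k]; last exact: My.
by rewrite Myi => le1; apply/eqP; rewrite eq_le My le1.
Qed.

(** The factor is the inverse of the best-response payoff, which becomes 1 after scaling, so that
    best responses turn into binding rows. *)
Lemma simplex_to_inQ y : inSimplex y ->
  exists2 v, 0 < v & [/\ inQ M (v *: y), bestresp_y M y = binding (v *: y)
    & labelsY M y = labelsQ M (v *: y)].
Proof.
move=> Xy; have [y0 _] := Xy.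
have [i0 Mi0] := payoff_pos y0 (simplex_neq0 Xy).
case: (@arg_maxP _ _ _ i0 predT (fun i => (M *m y) i ord0) isT) => i _ imax'.
have imax k : (M *m y) k ord0 <= (M *m y) i ord0 := imax' k isT.
have vi : 0 < (M *m y) i ord0 by rewrite (lt_le_trans Mi0) ?imax.
set v := (M *m y) i ord0 in vi imax *.
have Qy : inQ M (v^-1 *: y).
  split=> j; last by rewrite mxE mulr_ge0 ?invr_ge0 // ltW.
  by rewrite -scalemxAr mxE mulrC ler_pdivrMr // mul1r imax.
have best : bestresp_y M y = binding (v^-1 *: y).
  rewrite -(@bestresp_scale v^-1) ?invr_gt0 //; apply: (bestresp_binding (i := i)) => //.
  by rewrite inE -scalemxAr mxE mulVf ?eqxx // gt_eqF.
exists v^-1; first by rewrite invr_gt0.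
split=> //; apply: labelsYE best _ y0 Qy.2.
by rewrite supp_scale ?invr_gt0.
Qed.

(** The binding row makes [y] nonzero, so it can be normalized, and makes 1 the maximal payoff, so
    that binding rows are the best responses. *)
Lemma inQ_to_simplex y i : inQ M y -> i \in binding y ->
  exists y', [/\ inSimplex y', bestresp_y M y' = binding y & supp y' = supp y].
Proof.
move=> Qy iy; have [_ y0] := Qy.
have y_neq0 : y != 0.
  apply: contraTneq iy => ->; rewrite inE mulmx0 mxE eq_sym; exact: oner_neq0.
have s0 : 0 < \sum_j y j ord0.
  have /matrix0Pn[j [k]] := y_neq0; rewrite ord1 => yj.
  rewrite (bigD1 j) //=; apply: ltr_wpDr; first by apply: sumr_ge0.
  by rewrite lt_def yj y0.
exists ((\sum_j y j ord0)^-1 *: y); split.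
- split=> [j|]; first by rewrite mxE mulr_ge0 // invr_ge0 ltW.
  by under eq_bigr do rewrite mxE; rewrite -mulr_sumr mulVf // gt_eqF.
- by rewrite bestresp_scale ?invr_gt0 //; apply: bestresp_binding iy.
by rewrite supp_scale ?invr_gt0.
Qed.

(** * Dominance and redundancy *)

Lemma mixed_payoff (x : 'cV[R]_q) (y : 'cV[R]_p) :
  \sum_j (x^T *m M) ord0 j * y j ord0 = \sum_i x i ord0 * (M *m y) i ord0.
Proof.
transitivity ((x^T *m M *m y) ord0 ord0); first by rewrite [RHS]mxE.
by rewrite -mulmxA mxE; apply: eq_bigr => i _; rewrite mxE.
Qed.

(** Dominance and the other inequalities give $(My)_i\le x^\top My\le x_i(My)_i+(1-x_i)$. As $x\ne
    e_i$ means $x_i<1$, this yields $(My)_i\le1$. *)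
Lemma weakdom_redundant i : weakdom1 M i -> redundantQ M (lshift p i).
Proof.
move=> [x [[x0 x1] [x_neq Mx]]] y; split=> [Hy|[My y0] l _]; last first.
  by rewrite /ineqQ; case: split_ordP => j _.
have y0 j : 0 <= y j ord0.
  by have := Hy (rshift q j); rewrite eq_rlshift ineqQE !ineqE oppr_le0; apply.
have My k : k != i -> (M *m y) k ord0 <= 1.
  move=> ki; have := Hy (lshift p k); rewrite ineqQE !ineqE; apply.
  by rewrite eq_lshift.
have xi : x i ord0 < 1.
  rewrite -x1 (bigD1 i) //= ltrDl lt_def sumr_ge0 // andbT.
  apply: contra_neq x_neq => /eqP; rewrite psumr_eq0 // => /allP xk0.
  have {}xk0 k : k != i -> x k ord0 = 0.
    by move=> ki; have := xk0 k (mem_index_enum k); rewrite ki => /eqP.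
  apply/colP=> k; rewrite mxE eqxx andbT; have [->|/xk0//] := eqVneq k i.
  by rewrite -x1 (bigD1 i) //= big1 ?addr0 // => k' /xk0.
have Myi : (M *m y) i ord0 <= x i ord0 * (M *m y) i ord0 + (1 - x i ord0).
  have -> : 1 - x i ord0 = \sum_(k | k != i) x k ord0.
    by rewrite -x1 (bigD1 i) //= addrC addrK.
  apply: (@le_trans _ _ (\sum_k x k ord0 * (M *m y) k ord0)).
    rewrite -mixed_payoff mxE; apply: ler_sum => j _.
    exact: ler_wpM2r.
  rewrite (bigD1 i) //= lerD2l; apply: ler_sum => k ki.
  by rewrite -[leRHS]mulr1 ler_wpM2l // My.
split=> // k; have [->|/My//] := eqVneq k i.
rewrite -(ler_pM2l (_ : 0 < 1 - x i ord0)) ?subr_gt0 // mulr1.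
by rewrite mulrBl mul1r lerBlDl.
Qed.

(** A binding row forces $y\ne0$, and then $(My)_i<x^\top My\le1$. *)
Lemma strictdom_not_binding i y : strictdom1 M i -> inQ M y -> i \notin binding y.
Proof.
move=> [x [[x0 x1] Mx]] [My y0]; apply/negP=> iy.
have /matrix0Pn[j [k]] : y != 0.
  apply: contraTneq iy => ->; rewrite inE mulmx0 mxE eq_sym; exact: oner_neq0.
rewrite ord1 => yj; move: iy; rewrite inE; apply/negP; rewrite lt_eqF //.
apply: (@lt_le_trans _ _ (\sum_k x k ord0 * (M *m y) k ord0)).
  rewrite -mixed_payoff mxE (bigD1 j) //= [ltRHS](bigD1 j) //=.
  apply: ltr_leD; first by rewrite ltr_pM2r // lt_def yj y0.
  by apply: ler_sum => j' _; rewrite ler_wpM2r // ltW.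
rewrite -[leRHS]x1; apply: ler_sum => l _.
by rewrite -[leRHS]mulr1 ler_wpM2l.
Qed.

(** Farkas' lemma is applied to the differences between the rows of [M] and row [i]. A solution
    normalizes to a strictly dominating strategy; the alternative is a strategy with best response
    [i], which scales to a point of $Q$ where [i] is binding. *)
Lemma not_binding_strictdom i : (0 < p)%N ->
  (forall y, inQ M y -> i \notin binding y) -> strictdom1 M i.
Proof.
move=> p0 not_best.
have [[x x0 Hx]|[y [y0 Hy sum_y]]] :=
  farkas_le (M - const_mx 1 *m row i M)^T (const_mx 1).
  have DE j : ((M - const_mx 1 *m row i M)^T *m x) j ord0 =
      (x^T *m M) ord0 j - (\sum_k x k ord0) * M i j.
    rewrite mulr_suml !mxE -sumrB; apply: eq_bigr => k _.
    by rewrite !mxE big_ord1 !mxE mul1r mulrBl mulrC [M i j * _]mulrC.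
  have {}Hx j : (\sum_k x k ord0) * M i j < (x^T *m M) ord0 j.
    by have := Hx j; rewrite DE mxE -subr_gt0; apply: lt_le_trans.
  have s0 : 0 < \sum_k x k ord0.
    (* A column exists since $p>0$; there zero weights would give $0<0$. *)
    rewrite lt_def sumr_ge0 // andbT; apply: contraTneq (Hx (Ordinal p0)) => s0.
    rewrite s0 mul0r (_ : x = 0) ?trmx0 ?mul0mx ?mxE ?ltxx //.
    move/eqP: s0; rewrite psumr_eq0 // => /allP xk0.
    by apply/colP=> k; have /eqP-> := xk0 k (mem_index_enum k); rewrite mxE.
  exists ((\sum_k x k ord0)^-1 *: x); split.
    split=> [k|]; first by rewrite mxE mulr_ge0 // invr_ge0 ltW.
    by under eq_bigr do rewrite mxE; rewrite -mulr_sumr mulVf // gt_eqF.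
  move=> j; rewrite linearZ /= -scalemxAl mxE mulrC ltr_pdivlMr //.
  by rewrite mulrC.
have {}sum_y : 0 < \sum_j y j ord0.
  move: sum_y; rewrite mxE; congr (_ < _); apply: eq_bigr => j _.
  by rewrite !mxE mul1r.
pose y' := (\sum_j y j ord0)^-1 *: y.
have Xy' : inSimplex y'.
  split=> [k|]; first by rewrite mxE mulr_ge0 // invr_ge0 ltW.
  by under eq_bigr do rewrite mxE; rewrite -mulr_sumr mulVf // gt_eqF.
have iy' : i \in bestresp_y M y'.
  rewrite bestresp_scale ?invr_gt0 // inE; apply/forallP => k.
  have := Hy k; rewrite trmxK mulmxBl -mulmxA -row_mul mxE [X in _ + X]mxE.
  by rewrite [X in _ - X]mxE big_ord1 !mxE mul1r subr_le0.
have [v v0 [Qv best_v _]] := simplex_to_inQ Xy'.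
by have := not_best _ Qv; rewrite -best_v iy'.
Qed.

(* By Farkas, M_i <= x^T M for some x >= 0 with x_i = 0 and total weight at most 1:
   weight 1 is dominance, and a smaller weight keeps (M y)_i below 1. *)
Lemma redundant_cases i : redundantQ M (lshift p i) ->
  (forall y, inQ M y -> i \notin binding y) \/ weakdom1 M i.
Proof.
move=> i_red.
(* Zeroing row [i] prevents it from dominating itself; the extra row of $-1$ below bounds the total
   weight by 1. *)
pose M' : 'M_(q, p) := \matrix_(k, j) (if k == i then 0 else M k j).
have [[x x0 Hx]|[z [z0 Hz bz]]] :=
  farkas_le (col_mx M'^T (const_mx (- 1) : 'rV_q)) (col_mx (row i M)^T (- 1%:M : 'M_1)).
  pose x' := \col_k (if k == i then 0 else x k ord0).
  have x'0 k : 0 <= x' k ord0 by rewrite mxE; case: ifP.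
  have Mx' j : M i j <= (x'^T *m M) ord0 j.
    have := Hx (lshift 1 j); rewrite mul_col_mx !col_mxEu !mxE; congr (_ <= _).
    apply: eq_bigr => k _; rewrite !mxE; case: ifP; rewrite ?mul0r ?mulr0 // => _.
    by rewrite mulrC.
  have sum_x' : \sum_k x' k ord0 <= 1.
    have := Hx (rshift p ord0); rewrite mul_col_mx !col_mxEd !mxE eqxx.
    under eq_bigr do rewrite mxE mulN1r.
    rewrite sumrN lerN2; apply: le_trans; apply: ler_sum => k _.
    by rewrite mxE; case: ifP.
  move: sum_x'; rewrite le_eqVlt => /orP[/eqP sum_x'|sum_x'].
    right; exists x'; split=> //; split=> //.
    by apply/eqP=> /colP/(_ i)/eqP; rewrite !mxE !eqxx eq_sym oner_eq0.
  left=> y [My y0]; rewrite inE lt_eqF //; apply: le_lt_trans sum_x'.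
  apply: (@le_trans _ _ (\sum_k x' k ord0 * (M *m y) k ord0)).
    rewrite -mixed_payoff mxE; apply: ler_sum => j _; exact: ler_wpM2r.
  by apply: ler_sum => k _; rewrite -[leRHS]mulr1 ler_wpM2l.
(* The Farkas alternative is a pair $(y,t)$ with $(My)_k\le t$ for $k\ne i$ and $(My)_i>t$. *)
pose y := usubmx z; pose t := z (rshift p ord0) ord0; pose v := (M *m y) i ord0.
have zE : z = col_mx y (dsubmx z) by rewrite vsubmxK.
have t0 : 0 <= t by exact: z0.
have tv : t < v.
  move: bz; rewrite zE tr_col_mx trmxK mul_row_col mxE [X in _ + X]mxE big_ord1 -row_mul.
  by rewrite !mxE !eqxx mulN1r subr_gt0 /t /v mxE.
have My k : k != i -> (M *m y) k ord0 <= t.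
  move=> ki; have := Hz k; rewrite tr_col_mx trmxK zE mul_row_col mxE [X in _ + X]mxE.
  rewrite big_ord1 !mxE mulN1r subr_le0; apply: le_trans; apply: ler_sum => j _.
  by rewrite !mxE (negPf ki).
have tv0 : 0 < t + v by rewrite ltr_wpDl // (le_lt_trans t0).
(* Scaling the midpoint of $t$ and $v$ to 1 gives $st<1<sv$, so [s *: y] violates only inequality
   [i]. *)
pose s := 2 / (t + v).
have s0 : 0 < s by rewrite divr_gt0.
have /i_red [+ _] : forall l', l' != lshift p i -> ineqQ M l' (s *: y).
  move=> l; rewrite ineqQE; case: (split_ordP l) => j -> lj; rewrite !ineqE.
    rewrite -scalemxAr mxE; apply: (@le_trans _ _ (s * t)).
      by rewrite ler_pM2l // My // -(eq_lshift p).
    by rewrite /s mulrAC ler_pdivrMr // mul1r mulrDl mul1r lerD2l ltW.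
  by rewrite oppr_le0 !mxE mulr_ge0 ?(ltW s0).
move/(_ i); rewrite -scalemxAr mxE -/v leNgt => /negP[].
by rewrite /s mulrAC ltr_pdivlMr // mul1r mulrDl mul1r ltrD2r.
Qed.

(** At the origin all nonnegativity constraints bind and no payoff row does, so the binding rows are
    independent. *)
Lemma nonneg_not_redundant j : ~ redundantQ M (rshift q j).
Proof.
have Q0 := inQ0.
have indep : row_indep ineq_mx (labelsQ M 0).
  apply/row_indep_labelsQ => // lam _ i; rewrite inE mulmx0 mxE eq_sym.
  by rewrite oner_eq0.
move/redundantQE/(binding_not_redundant (x := 0)).
rewrite -inQE -labelsQE => /(_ Q0 indep)/negP; apply.
by rewrite labelsQ_rshift mxE.
Qed.


(** * Equivalent conditions for a single bounded polytope *)

Definition labels_le := forall y, inQ M y -> (#|labelsQ M y| <= p)%N.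

Definition labels_indep := forall y, inQ M y -> row_indep ineq_mx (labelsQ M y).

Lemma labels_le_indep : labels_le <-> labels_indep.
Proof.
rewrite /labels_le /labels_indep.
split=> [le_p y|indep y Qy]; last exact: row_indep_card (indep y Qy).
rewrite labelsQE inQE; apply: tight_row_indep; first by rewrite -inQE.
by move=> x; rewrite -inQE -labelsQE; apply: le_p.
Qed.

(** Without a binding payoff row the count is trivial; otherwise rescaling between the simplex and
    $Q$ preserves the support and matches best responses with binding rows. *)
Lemma nondegenerate_labels_le :
  (forall y, inSimplex y -> #|bestresp_y M y| <= #|supp y|)%N <-> labels_le.
Proof.
split=> [nondeg y Qy|le_p y Xy].
  rewrite labelsQ_le //; have [->|[i iy]] := set_0Vmem (binding y); first by rewrite cards0.
  by have [y' [Xy' <- <-]] := inQ_to_simplex Qy iy; exact: nondeg.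
have [v v0 [Qy -> _]] := simplex_to_inQ Xy.
by rewrite -(supp_scale y v0) -labelsQ_le //; exact: le_p.
Qed.

Lemma rows_indep_labels_indep :
  (forall y, inSimplex y -> rows_indep M (bestresp_y M y) (supp y)) <-> labels_indep.
Proof.
split=> [indep y Qy|indep y Xy].
  apply/row_indep_labelsQ => //.
  have [->|[i iy]] := set_0Vmem (binding y); first by move=> lam _ i; rewrite inE.
  by have [y' [Xy' <- <-]] := inQ_to_simplex Qy iy; exact: indep.
have [v v0 [Qy -> _]] := simplex_to_inQ Xy.
by rewrite -(supp_scale y v0); apply/row_indep_labelsQ => //; exact: indep.
Qed.

(** From the dimensions only nonnegativity is needed: the face contains the rescaled strategy, hence
    is nonempty, and so has at most [p] labels. *)
Lemma affdim_labels_indep :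
  (forall y, inSimplex y -> affdim (QJ M (labelsY M y)) (p%:Z - #|labelsY M y|%:Z)) <->
  labels_indep.
Proof.
split=> [dimE|indep y Xy]; last first.
  have [v v0 [Qy _ ->]] := simplex_to_inQ Xy; have := indep _ Qy.
  rewrite QJE labelsQE; apply: affdim_tight_on; by rewrite -inQE.
apply/labels_le_indep/nondegenerate_labels_le => y Xy; have := dimE y Xy.
have [v v0 [Qy -> ->]] := simplex_to_inQ Xy.
rewrite -(supp_scale y v0) -labelsQ_le // => -[[_ empty]|[N [dimN _]]].
  by case: (empty (v *: y)).
by rewrite -lez_nat -subr_ge0 dimN.
Qed.

Lemma labels_le_simple : labels_le -> simple_polytope (inQ M).
Proof.
move=> le_p; have [y0 strict] := inQ_interior.
rewrite inQE; apply: (simple_polyhedron strict); first by rewrite -inQE.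
by move=> y; rewrite -inQE -labelsQE; exact: le_p.
Qed.

Lemma labels_le_irredundant : labels_le ->
  forall l, redundantQ M l -> forall y, inQ M y -> l \notin labelsQ M y.
Proof.
move=> /labels_le_indep indep l /redundantQE l_red y Qy.
have := indep _ Qy; rewrite labelsQE => ind.
by apply: binding_not_redundant => //; rewrite -inQE.
Qed.

Lemma irredundant_labels_le : simple_polytope (inQ M) ->
  (forall l, redundantQ M l -> forall y, inQ M y -> l \notin labelsQ M y) -> labels_le.
Proof.
move=> Q_simple irred y Qy; have [y0 strict] := inQ_interior.
rewrite labelsQE; apply: (simple_irredundant_tight_card strict); rewrite -inQE //.
by move=> l /redundantQE l_red x Qx; rewrite -labelsQE; exact: irred l_red x Qx.
Qed.

(** Nonnegativity constraints are never redundant, so only payoff rows matter. For these, redundancy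
    corresponds to weak dominance unless the row never binds, and never binding to strict
    dominance. *)
Lemma irredundant_dominance :
  (forall l, redundantQ M l -> forall y, inQ M y -> l \notin labelsQ M y) <->
  (forall i, weakdom1 M i -> strictdom1 M i).
Proof.
split=> [irred i wdom|dom l l_red y Qy].
  (* Without columns strict dominance is vacuous, and the weakly dominating strategy serves. *)
  have [p0|] := posnP p.
    have [x [Xx _]] := wdom; exists x; split=> // j.
    by have := ltn_ord j; rewrite [X in (_ < X)%N]p0.
  move=> p0; apply: not_binding_strictdom => // y Qy.
  by rewrite -labelsQ_lshift; apply: irred => //; exact: weakdom_redundant.
case: (split_ordP l) l_red => j -> l_red; last by case: (nonneg_not_redundant l_red).
rewrite labelsQ_lshift; have [/(_ y Qy)//|/dom sdom] := redundant_cases l_red.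
exact: strictdom_not_binding.
Qed.

End BestResponsePolyhedron.

(** * Freeness of the binding rows as a sequence of vectors *)

Lemma free_mapP (R : fieldType) (V : vectType R) (I : eqType) (F : I -> V) (s : seq I) :
  uniq s ->
  free [seq F i | i <- s] <->
  (forall k : I -> R, \sum_(i <- s) k i *: F i = 0 -> forall i, i \in s -> k i = 0).
Proof.
move=> s_uniq.
have sumE (k : 'I_(size s) -> R) :
    \sum_i k i *: [tuple of map F (in_tuple s)]`_i = \sum_i k i *: F (tnth (in_tuple s) i).
  by apply: eq_bigr => i _; rewrite -tnth_nth tnth_map.
split=> [/(freeP (X := [tuple of map F (in_tuple s)])) s_free k k0 i i_s|indep].
  have := s_free (fun j => k (tnth (in_tuple s) j)); rewrite sumE.
  have -> : \sum_j k (tnth (in_tuple s) j) *: F (tnth (in_tuple s) j) = 0.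
    by rewrite -[RHS]k0 [RHS]big_tnth.
  by move=> k00; case/seq_tnthP: i_s => j ->; apply: k00.
apply/(freeP (X := [tuple of map F (in_tuple s)])) => k; rewrite sumE => k0 i.
pose k' x := if insub (index x s) is Some j then k j else 0.
have k'E j : k' (tnth (in_tuple s) j) = k j.
  rewrite /k' (tnth_nth (tnth (in_tuple s) j)) /= index_uniq //.
  by rewrite insubT //= => lt_j; congr k; apply: val_inj.
rewrite -k'E; apply: indep; last by rewrite mem_tnth.
by rewrite big_tnth -[RHS]k0; apply: eq_bigr => j _; rewrite k'E.
Qed.

(** The sequence lists the unit vectors first and unnegated, whereas [ineq_mx] has their negatives
    last; neither the order nor the signs affect independence. *)
Lemma free_labelsQ (R : realFieldType) (q p : nat) (M : 'M[R]_(q, p)) (y : 'cV[R]_p) :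
  inQ M y ->
  free ([seq (delta_mx ord0 i : 'rV[R]_p) | i in [set i | y i ord0 == 0]] ++
        [seq row j M | j in binding M y]) <->
  row_indep (ineq_mx M) (labelsQ M y).
Proof.
move=> Qy.
pose F (l : 'I_(q + p)) : 'rV[R]_p :=
  match split l with inl j => row j M | inr i => delta_mx ord0 i end.
have Fl j : F (lshift p j) = row j M.
  by rewrite /F; case: split_ordP => i => [/lshift_inj ->//|/eqP]; rewrite eq_lrshift.
have Fr i : F (rshift q i) = delta_mx ord0 i.
  by rewrite /F; case: split_ordP => j => [/eqP|/rshift_inj ->//]; rewrite eq_rlshift.
pose s := map (@rshift q p) (enum [set i | y i ord0 == 0]) ++
          map (@lshift q p) (enum (binding M y)).
have s_uniq : uniq s.
  rewrite cat_uniq !map_inj_uniq ?enum_uniq ?andbT /=;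
    [| exact: lshift_inj | exact: rshift_inj].
  apply/hasP=> -[_ /mapP[j _ ->] /mapP[i _ /eqP]]; by rewrite eq_lrshift.
have sE l : (l \in s) = (l \in labelsQ M y).
  rewrite mem_cat; case: (split_ordP l) => j ->.
    rewrite labelsQ_lshift (mem_map (@lshift_inj _ _)) mem_enum orbC.
    case: (j \in _) => //=; apply/mapP=> -[i _ /eqP]; by rewrite eq_lrshift.
  rewrite labelsQ_rshift (mem_map (@rshift_inj _ _)) mem_enum inE.
  case: (_ == _) => //=; apply/mapP=> -[i _ /eqP]; by rewrite eq_rlshift.
have -> : [seq (delta_mx ord0 i : 'rV[R]_p) | i in [set i | y i ord0 == 0]] ++
    [seq row j M | j in binding M y] = [seq F l | l <- s].
  rewrite map_cat -!map_comp; congr (_ ++ _); apply: eq_map => i /=.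
    by rewrite Fr.
  by rewrite Fl.
apply: iff_trans (free_mapP _ s_uniq) _.
have sumE (k : 'I_(q + p) -> R) (lam : 'rV_(q + p)) :
    (forall l, l \notin s -> k l = 0 /\ lam ord0 l = 0) ->
    (forall j, lam ord0 (lshift p j) = k (lshift p j)) ->
    (forall i, lam ord0 (rshift q i) = - k (rshift q i)) ->
    \sum_(l <- s) k l *: F l = lam *m ineq_mx M.
  move=> k0 lamL lamR; rewrite -[lam]hsubmxK mul_row_col mulmxN mulmx1.
  rewrite big_cat !big_map /= addrC; congr (_ + _).
    rewrite mulmx_sum_row [RHS](bigID (mem (binding M y))) /=.
    rewrite [X in _ = _ + X]big1 => [|j jy].
      rewrite addr0 big_enum; apply: eq_bigr => j _; by rewrite Fl mxE lamL.
    by rewrite mxE (k0 _ _).2 ?scale0r // sE labelsQ_lshift.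
  rewrite [X in _ = - X]row_sum_delta -sumrN.
  rewrite [RHS](bigID (mem [set i | y i ord0 == 0])) /=.
  rewrite [X in _ = _ + X]big1 => [|j jy].
    by rewrite addr0 big_enum; apply: eq_bigr => j _; rewrite Fr mxE lamR scaleNr opprK.
  rewrite mxE (k0 _ _).2 ?scale0r ?oppr0 // sE labelsQ_rshift.
  by move: jy; rewrite inE.
split=> [indep lam lam0 lamW|indep k k0 l ls].
  (* Coefficients of unit vectors change sign, as [ineq_mx] contains their negatives. *)
  pose k l := match split l with inl _ => lam ord0 l | inr _ => - lam ord0 l end.
  have k_s l : l \in s -> k l = 0.
    apply: (indep k); rewrite (sumE k lam) //.
    - move=> l' l's; have lam_l : lam ord0 l' = 0 by apply: lam0; rewrite -sE.
      by rewrite /k lam_l oppr0; case: split.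
    - by move=> j; rewrite /k; case: split_ordP => // i /eqP; rewrite eq_lrshift.
    - move=> j; rewrite /k; case: split_ordP => [i /eqP|]; rewrite ?eq_rlshift //.
      by rewrite opprK.
  apply/rowP=> l; rewrite [RHS]mxE; have [ls|] := boolP (l \in s).
    by have := k_s l ls; rewrite /k; case: split => // _ /eqP; rewrite oppr_eq0 => /eqP.
  by rewrite sE; exact: lam0.
pose lam : 'rV_(q + p) := \row_l (if l \in s then
  match split l with inl _ => k l | inr _ => - k l end else 0).
pose k' l := if l \in s then k l else 0.
have: lam = 0.
  apply: indep => [l'|]; first by rewrite mxE -sE => /negPf ->.
  rewrite -(sumE k' lam).
  - by rewrite -[RHS]k0 !big_seq; apply: eq_bigr => l' l's; rewrite /k' l's.
  - by move=> l' /negPf l's; rewrite mxE /k' l's.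
  - move=> j; rewrite mxE /k'; case: ifP => // _.
    by case: split_ordP => // i /eqP; rewrite eq_lrshift.
  - move=> j; rewrite mxE /k'; case: ifP => [_|]; last by rewrite oppr0.
    by case: split_ordP => // i /eqP; rewrite eq_rlshift.
move/rowP/(_ l); rewrite !mxE ls; case: split => // _ /eqP.
by rewrite oppr_eq0 => /eqP.
Qed.

(** * The polytope $P$ as the polytope $Q$ of the transposed matrix *)

Section Transposition.
Variables (R : realFieldType) (m n : nat) (B : 'M[R]_(m, n)).

(** Transposition exchanges the two blocks of labels, which have the types ['I_(m + n)] and
    ['I_(n + m)]. *)
Definition swap_label (l : 'I_(m + n)) : 'I_(n + m) :=
  match split l with inl i => rshift n i | inr j => lshift m j end.

Lemma swap_label_lshift i : swap_label (lshift n i) = rshift n i.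
Proof.
by rewrite /swap_label; case: split_ordP => j => [/lshift_inj ->//|/eqP]; rewrite eq_lrshift.
Qed.

Lemma swap_label_rshift j : swap_label (rshift m j) = lshift m j.
Proof.
by rewrite /swap_label; case: split_ordP => i => [/eqP|/rshift_inj ->//]; rewrite eq_rlshift.
Qed.

Lemma swap_label_inj : injective swap_label.
Proof.
move=> l l'; case: (split_ordP l) => i ->; case: (split_ordP l') => j ->;
  rewrite ?swap_label_lshift ?swap_label_rshift.
- by move/rshift_inj ->.
- by move/eqP; rewrite eq_rlshift.
- by move/eqP; rewrite eq_lrshift.
by move/lshift_inj ->.
Qed.

Lemma swap_label_surj l' : exists l, swap_label l = l'.
Proof.
case: (split_ordP l') => i ->; first by exists (rshift m i); rewrite swap_label_rshift.
by exists (lshift n i); rewrite swap_label_lshift.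
Qed.

Lemma inP_tr : inP B = inQ B^T.
Proof.
apply: functional_extensionality => x; apply: propositional_extensionality.
by split=> -[].
Qed.

Lemma labelsP_tr x : labelsP B x = swap_label @^-1: labelsQ B^T x.
Proof.
apply/setP=> l; rewrite 2!inE; case: split_ordP => i ->.
  by rewrite swap_label_lshift labelsQ_rshift.
by rewrite swap_label_rshift labelsQ_lshift inE.
Qed.

Lemma labelsX_tr x : labelsX B x = swap_label @^-1: labelsY B^T x.
Proof.
apply/setP=> l; rewrite 3!inE; case: split_ordP => i ->.
  rewrite swap_label_lshift; case: split_ordP => j => [/eqP|/rshift_inj ->//].
  by rewrite eq_rlshift.
rewrite swap_label_rshift; case: split_ordP => j => [/lshift_inj ->//|/eqP].
by rewrite eq_lrshift.
Qed.

Lemma card_swap_label (S : {set 'I_(n + m)}) : #|swap_label @^-1: S| = #|S|.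
Proof.
rewrite -(card_imset _ swap_label_inj); apply: eq_card => l.
apply/imsetP/idP => [[l' + ->]|lS]; first by rewrite inE.
by have [l' l'l] := swap_label_surj l; exists l'; rewrite // inE l'l.
Qed.

Lemma PI_tr x : PI B (labelsX B x) = QJ B^T (labelsY B^T x).
Proof.
apply: functional_extensionality => y; apply: propositional_extensionality.
rewrite /PI /QJ inP_tr labelsP_tr labelsX_tr.
suff -> : (swap_label @^-1: labelsY B^T x \subset swap_label @^-1: labelsQ B^T y) =
  (labelsY B^T x \subset labelsQ B^T y) by [].
have memE S l : (l \in swap_label @^-1: S) = (swap_label l \in S) by rewrite inE.
apply/subsetP/subsetP => sub l; last by rewrite !memE; apply: sub.
by have [l' <-] := swap_label_surj l; move: (sub l'); rewrite !memE.
Qed.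

Lemma ineqP_tr l x : ineqP B l x = ineqQ B^T (swap_label l) x.
Proof.
rewrite ineqQE /ineqP; case: split_ordP => i ->.
  by rewrite swap_label_lshift !ineqE oppr_le0.
by rewrite swap_label_rshift !ineqE.
Qed.

Lemma redundantP_tr l : redundantP B l <-> redundantQ B^T (swap_label l).
Proof.
rewrite /redundantP /redundantQ inP_tr; split=> red x; rewrite -red; split=> H l' l'l.
- by rewrite ineqP_tr; apply: H; rewrite (inj_eq swap_label_inj).
- have [l'' l''E] := swap_label_surj l'; rewrite -l''E -ineqP_tr; apply: H.
  by rewrite -(inj_eq swap_label_inj) l''E.
- have [l'' l''E] := swap_label_surj l'; rewrite -l''E -ineqP_tr; apply: H.
  by rewrite -(inj_eq swap_label_inj) l''E.
by rewrite ineqP_tr; apply: H; rewrite (inj_eq swap_label_inj).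
Qed.

Lemma irredundantP_tr :
  (forall l, redundantP B l -> forall x, inP B x -> l \notin labelsP B x) <->
  (forall l, redundantQ B^T l -> forall x, inQ B^T x -> l \notin labelsQ B^T x).
Proof.
split=> irred l.
  have [l' <-] := swap_label_surj l => /redundantP_tr red x.
  by rewrite -inP_tr => /(irred _ red); rewrite labelsP_tr inE.
move=> /redundantP_tr red x; rewrite inP_tr labelsP_tr inE.
exact: irred.
Qed.

Lemma weakdom2_tr j : weakdom2 B j <-> weakdom1 B^T j.
Proof.
split=> -[y [Xy [y_neq By]]]; exists y; split=> //; split=> // i; move: (By i);
  by rewrite -trmx_mul !mxE.
Qed.

Lemma strictdom2_tr j : strictdom2 B j <-> strictdom1 B^T j.
Proof.
by split=> -[y [Xy By]]; exists y; split=> // i; move: (By i);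
  rewrite -trmx_mul !mxE.
Qed.

Lemma cols_indep_tr I J : cols_indep B I J <-> rows_indep B^T J I.
Proof.
split=> indep mu mu0; apply: indep => i iI; rewrite -[RHS](mu0 i iI);
  by apply: eq_bigr => j _; rewrite mxE mulrC.
Qed.

End Transposition.

(** * The symmetric game and the product polytope *)

Section SymmetricGame.
Variables (R : realFieldType) (m n : nat) (A B : 'M[R]_(m, n)).

Definition symmetric_mx : 'M[R]_(m + n) := block_mx 0 A B^T 0.

Lemma symmetric_mx_mul (x : 'cV[R]_m) (y : 'cV[R]_n) :
  symmetric_mx *m col_mx x y = col_mx (A *m y) (B^T *m x).
Proof. by rewrite /symmetric_mx mul_block_col !mul0mx add0r addr0. Qed.

(** The zero diagonal blocks decouple the inequalities, so that $S=P\times Q$. *)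
Lemma inQ_symmetric (x : 'cV[R]_m) (y : 'cV[R]_n) :
  inQ symmetric_mx (col_mx x y) <-> inQ B^T x /\ inQ A y.
Proof.
rewrite /inQ symmetric_mx_mul; split=> [[Cz z0]|[[Bx x0] [Ay y0]]].
  split; split=> i.
  - by have := Cz (rshift m i); rewrite col_mxEd.
  - by have := z0 (lshift n i); rewrite col_mxEu.
  - by have := Cz (lshift n i); rewrite col_mxEu.
  - by have := z0 (rshift m i); rewrite col_mxEd.
by split=> l; case: (split_ordP l) => i ->; rewrite ?col_mxEu ?col_mxEd.
Qed.

Lemma card_labelsQ_symmetric (x : 'cV[R]_m) (y : 'cV[R]_n) :
  (#|labelsQ symmetric_mx (col_mx x y)| = #|labelsQ B^T x| + #|labelsQ A y|)%N.
Proof.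
rewrite !card_labelsQ addnACA (addnC #|binding B^T x|).
congr (_ + _)%N; rewrite card_ord_split; congr (_ + _)%N; apply: eq_card => i;
  by rewrite !inE ?symmetric_mx_mul ?col_mxEu ?col_mxEd.
Qed.

Lemma card_labelsQ0 q p (M : 'M[R]_(q, p)) : #|labelsQ M 0| = p.
Proof.
rewrite card_labelsQ (_ : binding M 0 = set0); last first.
  by apply/setP=> i; rewrite !inE mulmx0 mxE eq_sym oner_eq0.
by rewrite card_zeros => [|j]; rewrite ?mxE // cards0 (_ : supp _ = set0) ?cards0 ?subn0 //;
  apply/setP=> j; rewrite !inE mxE ltxx.
Qed.

(** Labels add up over the two factors. Pairing a point with the origin, which has exactly as many
    labels as its dimension, recovers the bound for each factor. *)
Lemma labels_le_symmetric :
  labels_le symmetric_mx <-> labels_le A /\ labels_le B^T.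
Proof.
split=> [le_mn|[leA leB] z].
  split=> [y Qy|x Px].
    have /le_mn : inQ symmetric_mx (col_mx 0 y) by apply/inQ_symmetric; split=> //; exact: inQ0.
    by rewrite card_labelsQ_symmetric card_labelsQ0 leq_add2l.
  have /le_mn : inQ symmetric_mx (col_mx x 0) by apply/inQ_symmetric; split=> //; exact: inQ0.
  by rewrite card_labelsQ_symmetric card_labelsQ0 leq_add2r.
rewrite -[z]vsubmxK => /inQ_symmetric[Px Qy].
by rewrite card_labelsQ_symmetric leq_add ?leA ?leB.
Qed.

Lemma bounded_inQ_symmetric : bounded_set (inQ B^T) -> bounded_set (inQ A) ->
  bounded_set (inQ symmetric_mx).
Proof.
move=> [MB HB] [MA HA]; exists (Num.max MB MA) => z.
rewrite -[z]vsubmxK => /inQ_symmetric[Px Qy] l; rewrite le_max.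
case: (split_ordP l) => i ->; first by rewrite col_mxEu HB.
by rewrite col_mxEd HA ?orbT.
Qed.

End SymmetricGame.

(** Covers $m=0$ or $n=0$: boundedness makes both simplices empty or both nonempty. *)
Lemma simplex_transfer (R : realFieldType) (q p : nat) (M : 'M[R]_(q, p)) (y : 'cV[R]_p) :
  bounded_set (inQ M) -> inSimplex y -> exists x : 'cV[R]_q, inSimplex x.
Proof.
move=> Qb Xy; have [i _] := payoff_pos Qb Xy.1 (simplex_neq0 Xy).
exists (delta_mx i ord0); split=> [k|]; first by rewrite mxE ler0n.
rewrite (bigD1 i) //= big1 => [|k /negPf ki]; first by rewrite mxE !eqxx addr0.
by rewrite mxE ki.
Qed.

(** * The equivalence of the nine conditions *)

Unset Implicit Arguments.

Theorem mainTheorem11 (R : realFieldType) (m n : nat) (A B : 'M[R]_(m, n))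
  (hP : bounded_set (inP B)) (hQ : bounded_set (inQ A)) :
  let C : 'M[R]_(m + n) := block_mx 0 A B^T 0 in
  let inS := fun z : 'cV[R]_(m + n) =>
    (forall i, 0 <= z i ord0) /\ (forall j, (C *m z) j ord0 <= 1) in
  let cond_a := nondeg_game A B in
  let cond_b :=
    (forall x, inP B x -> #|labelsP B x| <= m)%N /\
    (forall y, inQ A y -> #|labelsQ A y| <= n)%N in
  let cond_c := nondeg_game C C^T in
  let cond_d := forall z, inS z ->
    (#|[set i | z i ord0 == 0%R]| + #|[set j | (C *m z) j ord0 == 1%R]| <= m + n)%N in
  let cond_e := forall z, inS z ->
    free ([seq (delta_mx ord0 i : 'rV[R]_(m + n)) | i in [set i | z i ord0 == 0]] ++
          [seq row j C | j in [set j | (C *m z) j ord0 == 1]]) in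
  let cond_f := forall (xh : 'cV[R]_m) (yh : 'cV[R]_n), inSimplex xh -> inSimplex yh ->
    cols_indep B (supp xh) (bestresp_x B xh) /\
    rows_indep A (bestresp_y A yh) (supp yh) in
  let cond_g := forall (xh : 'cV[R]_m) (yh : 'cV[R]_n), inSimplex xh -> inSimplex yh ->
    affdim (PI B (labelsX B xh)) (m%:Z - #|labelsX B xh|%:Z) /\
    affdim (QJ A (labelsY A yh)) (n%:Z - #|labelsY A yh|%:Z) in
  let cond_h :=
    simple_polytope (inP B) /\ simple_polytope (inQ A) /\
    (forall l, redundantP B l -> forall x, inP B x -> l \notin labelsP B x) /\
    (forall l, redundantQ A l -> forall y, inQ A y -> l \notin labelsQ A y) in
  let cond_i :=
    simple_polytope (inP B) /\ simple_polytope (inQ A) /\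
    (forall i, weakdom1 A i -> strictdom1 A i) /\
    (forall j, weakdom2 B j -> strictdom2 B j) in
  (cond_a <-> cond_b) /\ (cond_a <-> cond_c) /\ (cond_a <-> cond_d) /\
  (cond_a <-> cond_e) /\ (cond_a <-> cond_f) /\ (cond_a <-> cond_g) /\
  (cond_a <-> cond_h) /\ (cond_a <-> cond_i).
Proof.
move=> C inS cond_a cond_b cond_c cond_d cond_e cond_f cond_g cond_h cond_i.
have bB : bounded_set (inQ B^T) by rewrite -inP_tr.
have bC : bounded_set (inQ C) by exact: bounded_inQ_symmetric.
have inSE z : inS z <-> inQ C z by split=> -[].
have Xempty : (exists x : 'cV[R]_m, inSimplex x) <-> (exists y : 'cV[R]_n, inSimplex y).
  by split=> -[z]; apply: simplex_transfer; [exact: bB|exact: hQ].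
(* Conditions (f) and (g) quantify over both strategies at once; separating the players requires a
   strategy of the other one. *)
have pairE (F : 'cV[R]_m -> Prop) (G : 'cV[R]_n -> Prop) :
    (forall x y, inSimplex x -> inSimplex y -> F x /\ G y) <->
    (forall y, inSimplex y -> G y) /\ (forall x, inSimplex x -> F x).
  split=> [FG|[HG HF] x y Xx Xy]; last by split; [exact: HF|exact: HG].
  split=> [y Xy|x Xx].
    by have [x Xx] := Xempty.2 (ex_intro _ y Xy); have [] := FG x y Xx Xy.
  by have [y Xy] := Xempty.1 (ex_intro _ x Xx); have [] := FG x y Xx Xy.
(* The pivot to which every condition is reduced. *)
pose T := labels_le A /\ labels_le B^T.
have labels_leC : labels_le C <-> T := labels_le_symmetric A B.
have aT : cond_a <-> T.
  split=> [[aB aA]|[leA leB]].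
    by split; [exact/(nondegenerate_labels_le hQ)|exact/(nondegenerate_labels_le bB)].
  by split; [exact/(nondegenerate_labels_le bB)|exact/(nondegenerate_labels_le hQ)].
have bT : cond_b <-> T.
  have bBE : (forall x, inP B x -> #|labelsP B x| <= m)%N <-> labels_le B^T.
    rewrite inP_tr; split=> le_m x /le_m; by rewrite labelsP_tr card_swap_label.
  by rewrite /cond_b bBE; split=> -[].
(* Both halves of nondegeneracy of $(C,C^\top)$ coincide, since [bestresp_x] transposes $C^\top$
   back to $C$. *)
have cT : cond_c <-> T.
  rewrite -labels_leC -(nondegenerate_labels_le bC) /cond_c /nondeg_game.
  by rewrite /bestresp_x trmxK; split=> [[]|].
have dT : cond_d <-> T.
  rewrite -labels_leC; split=> le_mn z /inSE /le_mn; by rewrite card_labelsQ addnC.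
have eT : cond_e <-> T.
  rewrite -labels_leC (labels_le_indep bC).
  split=> indep z.
    move=> Qz; apply/free_labelsQ => //; by apply/indep/inSE.
  by move=> /inSE Qz; apply/free_labelsQ => //; apply: indep.
have fT : cond_f <-> T.
  rewrite /T (labels_le_indep hQ) (labels_le_indep bB).
  rewrite -(rows_indep_labels_indep hQ) -(rows_indep_labels_indep bB).
  apply: iff_trans (pairE _ _) _; split=> -[fA fB]; split=> // x Xx.
    by apply/cols_indep_tr; exact: fB.
  by apply/cols_indep_tr; exact: fB.
have gT : cond_g <-> T.
  rewrite /T (labels_le_indep hQ) (labels_le_indep bB).
  rewrite -(affdim_labels_indep hQ) -(affdim_labels_indep bB).
  apply: iff_trans (pairE _ _) _; split=> -[gA gB]; split=> // x /gB.
    by rewrite PI_tr labelsX_tr card_swap_label.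
  by rewrite PI_tr labelsX_tr card_swap_label.
have hT : cond_h <-> T.
  rewrite /cond_h irredundantP_tr inP_tr.
  split=> [[sB [sA [iB iA]]]|[leA leB]].
    by split; apply: irredundant_labels_le.
  split; first exact: labels_le_simple.
  split; first exact: labels_le_simple.
  by split; apply: labels_le_irredundant.
have ih : cond_i <-> cond_h.
  have weakE : (forall j, weakdom2 B j -> strictdom2 B j) <->
      (forall j, weakdom1 B^T j -> strictdom1 B^T j).
    by split=> dom j /weakdom2_tr/dom/strictdom2_tr.
  rewrite /cond_i /cond_h weakE irredundantP_tr.
  rewrite (irredundant_dominance hQ) (irredundant_dominance bB).
  by split=> -[sB [sA []]].
have iT := iff_trans ih hT.
have toT c : (c <-> T) -> (cond_a <-> c) by move=> cT'; apply: iff_trans aT (iff_sym cT').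
by split; [|split; [|split; [|split; [|split; [|split; [|split]]]]]]; apply: toT.
Qed.
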